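(* Let $X$ be a non-empty set. The word problem for each of the free $X$-generated left strong, right strong and strong $F$-birestriction monoids $\mathsf{FFBR}_{ls}(X)$, $\mathsf{FFBR}_{rs}(X)$ and $\mathsf{FFBR}_{s}(X)$ is decidable.
   Context: A birestriction monoid is an algebra $(S;\cdot,{}^*,{}^+,1)$ such that $(S;\cdot,1)$ is a monoid and for all $x,y$: $xx^*=x$, $x^*y^*=y^*x^*$, $(xy^* )^*=x^*y^*$, $x^*y=y(xy)^*$; $x^+x=x$, $x^+y^+=y^+x^+$, $(x^+y)^+=x^+y^+$, $xy^+=(xy)^+x$; $(x^+)^*=x^+$, $(x^* )^+=x^*$. Its projections are $P(S)=\{s^*:s\in S\}=\{s^+:s\in S\}$; $s\le t$ iff $s=et$ for some $e\in P(S)$; $s\mathrel{\sigma}t$ iff $se=te$ for some $e\in P(S)$. An $F$-birestriction monoid is a birestriction monoid in which every $\sigma$-class has a maximum element with respect to $\le$; $s^{\mathfrak m}$ denotes the maximum element of the $\sigma$-class of $s$. $F$-birestriction monoids are regarded as algebras $(S;\cdot,{}^*,{}^+,{}^{\mathfrak m},1)$ of type $(2,1,1,1,0)$. Such a monoid is left strong if it satisfies $x^{\mathfrak m}y^{\mathfrak m}=(x^{\mathfrak m})^+(xy)^{\mathfrak m}$, right strong if it satisfies $x^{\mathfrak m}y^{\mathfrak m}=(xy)^{\mathfrak m}(y^{\mathfrak m})^*$, and strong if it is both left and right strong. Each class is a variety, and $\mathsf{FFBR}_{ls}(X)$, $\mathsf{FFBR}_{rs}(X)$, $\mathsf{FFBR}_{s}(X)$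 denote the free algebras on $X$ in these varieties. The word problem for such a free algebra is to decide, given two terms over $X$ in the signature $(\cdot,{}^*,{}^+,{}^{\mathfrak m},1)$, whether they have the same value in it. Letters of $X$ are treated as formal symbols. *)

(* Defs.v *)
From Stdlib Require Import FunctionalExtensionality PropExtensionality.
From Stdlib Require Import ClassicalEpsilon.

Set Implicit Arguments.
Unset Strict Implicit.
Unset Printing Implicit Defensive.

Record algebra : Type := Algebra {
  carrier :> Type;
  mul  : carrier -> carrier -> carrier;
  star : carrier -> carrier;
  plus : carrier -> carrier;
  maxi : carrier -> carrier;            (* [maxi s] is s^m *)
  one  : carrier
}.
Arguments one {a}.

Declare Scope alg_scope.
Local Notation "x * y" := (mul x y) : alg_scope.
Local Notation "x ^*" := (star x) (at level 2, left associativity, format "x ^*") : alg_scope.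
Local Notation "x ^+" := (plus x) (at level 2, left associativity, format "x ^+") : alg_scope.
Local Notation "x ^m" := (maxi x) (at level 2, left associativity, format "x ^m") : alg_scope.
Local Open Scope alg_scope.

Record birestriction_monoid (S : algebra) : Prop := {
  br_mulA    : forall x y z : S, x * (y * z) = (x * y) * z;
  br_mul1x   : forall x : S, one * x = x;
  br_mulx1   : forall x : S, x * one = x;
  br_starR   : forall x : S, x * x^* = x;
  br_starC   : forall x y : S, x^* * y^* = y^* * x^*;
  br_starM   : forall x y : S, (x * y^*)^* = x^* * y^*;
  br_starL   : forall x y : S, x^* * y = y * (x * y)^*;
  br_plusL   : forall x : S, x^+ * x = x;
  br_plusC   : forall x y : S, x^+ * y^+ = y^+ * x^+;
  br_plusM   : forall x y : S, (x^+ * y)^+ = x^+ * y^+;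
  br_plusR   : forall x y : S, x * y^+ = (x * y)^+ * x;
  br_plus_star : forall x : S, (x^+)^* = x^+;
  br_star_plus : forall x : S, (x^*)^+ = x^*
}.

Definition projection (S : algebra) (e : S) : Prop := exists s : S, e = s^*.

Definition natural_le (S : algebra) (s t : S) : Prop :=
  exists e : S, projection e /\ s = e * t.

Definition sigma (S : algebra) (s t : S) : Prop :=
  exists e : S, projection e /\ s * e = t * e.

Definition is_maximum (S : algebra) (C : S -> Prop) (m : S) : Prop :=
  C m /\ forall t : S, C t -> natural_le t m.

Definition F_birestriction_monoid (S : algebra) : Prop :=
  birestriction_monoid S /\ forall s : S, is_maximum (sigma s) s^m.

Definition left_strong_identity (S : algebra) : Prop :=
  forall x y : S, x^m * y^m = (x^m)^+ * (x * y)^m.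

Definition right_strong_identity (S : algebra) : Prop :=
  forall x y : S, x^m * y^m = (x * y)^m * (y^m)^*.

Definition left_strong (S : algebra) : Prop :=
  F_birestriction_monoid S /\ left_strong_identity S.

Definition right_strong (S : algebra) : Prop :=
  F_birestriction_monoid S /\ right_strong_identity S.

Definition strong (S : algebra) : Prop :=
  F_birestriction_monoid S /\ left_strong_identity S /\ right_strong_identity S.

Inductive term (X : Type) : Type :=
| tvar  : X -> term X
| tone  : term X
| tmul  : term X -> term X -> term X
| tstar : term X -> term X
| tplus : term X -> term X
| tmaxi : term X -> term X.
Arguments tone {X}.

Fixpoint value (X : Type) (S : algebra) (f : X -> S) (t : term X) : S :=
  match t with
  | tvar x => f x
  | tone => one
  | tmul u v => value f u * value f v
  | tstar u => (value f u)^*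
  | tplus u => (value f u)^+
  | tmaxi u => (value f u)^m
  end.

Record morphism (S T : algebra) (h : S -> T) : Prop := {
  morph_mul  : forall x y : S, h (x * y) = h x * h y;
  morph_star : forall x : S, h x^* = (h x)^*;
  morph_plus : forall x : S, h x^+ = (h x)^+;
  morph_maxi : forall x : S, h x^m = (h x)^m;
  morph_one  : h one = one
}.

(** Free algebras exist in the classes above: see [free_exists] below. *)
Definition is_free (V : algebra -> Prop) (X : Type) (F : algebra) (i : X -> F)
    : Prop :=
  V F /\
  forall (A : algebra) (f : X -> A), V A ->
    exists h : F -> A,
      (morphism h /\ forall x : X, h (i x) = f x) /\
      forall h' : F -> A, morphism h' -> (forall x : X, h' (i x) = f x) ->
        forall a : F, h' a = h a.

(** The model of computation is the language I of N. D. Jones (Computability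
    and Complexity from a Programming Perspective): WHILE programs with a single
    variable, ranging over binary trees.  It is Turing complete.  A notion of
    decidability stated with Rocq functions into [bool] would be void in the
    presence of classical axioms. *)

Inductive tree : Type :=
| leaf : tree
| node : tree -> tree -> tree.

Inductive expr : Type :=
| Var  : expr
| Nil  : expr
| Cons : expr -> expr -> expr
| Hd   : expr -> expr
| Tl   : expr -> expr.

Inductive program : Type :=
| Assign : expr -> program
| Seq    : program -> program -> program
| While  : expr -> program -> program.

Fixpoint eval (e : expr) (x : tree) : tree :=
  match e with
  | Var => x
  | Nil => leaf
  | Cons e1 e2 => node (eval e1 x) (eval e2 x)
  | Hd e1 => match eval e1 x with leaf => leaf | node l _ => l end
  | Tl e1 => match eval e1 x with leaf => leaf | node _ r => r end
  end.

(** [exec p x y]: started on [x], the program [p] halts with result [y].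
    In loop conditions [leaf] is false and every other tree is true. *)
Inductive exec : program -> tree -> tree -> Prop :=
| exec_assign e x : exec (Assign e) x (eval e x)
| exec_seq p q x y z : exec p x y -> exec q y z -> exec (Seq p q) x z
| exec_while_false e p x : eval e x = leaf -> exec (While e p) x x
| exec_while_true e p x y z :
    eval e x <> leaf -> exec p x y -> exec (While e p) y z ->
    exec (While e p) x z.

Definition tree_of_bool (b : bool) : tree :=
  if b then node leaf leaf else leaf.

Fixpoint tree_of_nat (n : nat) : tree :=
  match n with
  | O => leaf
  | S k => node leaf (tree_of_nat k)
  end.

(** Terms are presented to programs as trees whose left branch is a tag for the
    head symbol; [c] gives the names of the letters. *)
Fixpoint tree_of_term (X : Type) (c : X -> nat) (t : term X) : tree :=
  match t with
  | tvar x => node (tree_of_nat 0) (tree_of_nat (c x))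
  | tone => node (tree_of_nat 1) leaf
  | tmul u v => node (tree_of_nat 2) (node (tree_of_term c u) (tree_of_term c v))
  | tstar u => node (tree_of_nat 3) (tree_of_term c u)
  | tplus u => node (tree_of_nat 4) (tree_of_term c u)
  | tmaxi u => node (tree_of_nat 5) (tree_of_term c u)
  end.

Fixpoint occurs (X : Type) (x : X) (t : term X) : Prop :=
  match t with
  | tvar y => x = y
  | tone => False
  | tmul u v => occurs x u \/ occurs x v
  | tstar u | tplus u | tmaxi u => occurs x u
  end.

(** [c] gives distinct names to the letters of [s] and [t].  As [X] may be
    uncountable, injectivity is only required on these finitely many letters. *)
Definition names_letters (X : Type) (c : X -> nat) (s t : term X) : Prop :=
  forall x y : X, occurs x s \/ occurs x t -> occurs y s \/ occurs y t ->
    c x = c y -> x = y.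

(** The program does not depend on the names given to the letters. *)
Definition decidable_word_problem (X : Type) (F : algebra) (i : X -> F) : Prop :=
  exists p : program,
    forall (s t : term X) (c : X -> nat), names_letters c s t ->
      exists b : bool,
        exec p (node (tree_of_term c s) (tree_of_term c t)) (tree_of_bool b) /\
        (b = true <-> value i s = value i t).

Section Identities.
Variables (S : algebra) (HS : F_birestriction_monoid S).

Lemma maxi_ge (x : S) : exists s : S, x = s^* * x^m.
Proof.
destruct HS as [HB HM]; destruct (HM x) as [_ H].
destruct (H x) as [e [[s ->] E]]; [| now exists s].
exists (one^*); split; [now exists one | reflexivity].
Qed.

Lemma maxi_plus (x : S) : x = x^+ * x^m.
Proof.
destruct (maxi_ge x) as [s E]; destruct HS as [HB _].
assert (E' : x^+ = s^* * (x^m)^+).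
{ rewrite E at 1; rewrite <- (br_star_plus HB s), (br_plusM HB).
  now rewrite (br_star_plus HB). }
now rewrite E', <- (br_mulA HB), (br_plusL HB).
Qed.

Lemma maxi_starr (x y : S) : (x * y^*)^m = x^m.
Proof.
destruct HS as [HB HM].
assert (idem : forall z : S, z^* * z^* = z^*).
{ intro z; rewrite <- (br_starM HB); now rewrite (br_starR HB). }
assert (sig : forall a b : S, sigma a b -> sigma b a).
{ intros a b [e [P E]]; exists e; now split. }
assert (sigt : forall a b d : S, sigma a b -> sigma b d -> sigma a d).
{ intros a b d [e [[u ->] E]] [f [[v ->] E']].
  exists (u^* * v^*); split; [exists (u * v^*); now rewrite (br_starM HB) |].
  rewrite (br_mulA HB), E, <- (br_mulA HB), (br_starC HB u v).
  now rewrite !(br_mulA HB), E'. }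
assert (xy : sigma (x * y^*) x).
{ exists (y^*); split; [now exists y |]. now rewrite <- (br_mulA HB), idem. }
destruct (HM x) as [Mx Ux]; destruct (HM (x * y^*)) as [My Uy].
destruct (Ux (x * y^*)^m) as [e [[u ->] E]]; [eauto |].
destruct (Uy x^m) as [f [[v ->] E']]; [eauto |].
assert (ua : u^* * (x * y^*)^m = (x * y^*)^m).
{ now rewrite E at 1; rewrite (br_mulA HB), idem, <- E. }
rewrite E' in E; rewrite (br_mulA HB), (br_starC HB), <- (br_mulA HB), ua in E.
now rewrite E at 1.
Qed.
End Identities.

Lemma F_birestriction_of_identities (S : algebra) :
  birestriction_monoid S ->
  (forall x : S, x = x^+ * x^m) ->
  (forall x y : S, (x * y^*)^m = x^m) ->
  F_birestriction_monoid S.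
Proof.
intros HB H1 H2; split; [exact HB |]; intro s; split.
- exists ((s^+ * s^m)^*); split; [now exists (s^+ * s^m) |].
  pose proof (br_starL HB (s^+) (s^m)) as E.
  rewrite (br_plus_star HB) in E; rewrite <- E, <- H1.
  now rewrite (br_starR HB).
- intros t [e [[u ->] E]].
  exists (t^+); split; [exists (t^+); now rewrite (br_plus_star HB) |].
  now rewrite <- (H2 s u), E, (H2 t u), <- H1.
Qed.

Section Free.
Variables (V : algebra -> Prop) (X : Type).

Let eqv (s t : term X) : Prop :=
  forall (A : algebra) (f : X -> A), V A -> value f s = value f t.

Let canon (t : term X) : term X := epsilon (inhabits t) (eqv t).

Let canonP t : eqv t (canon t).
Proof. apply epsilon_spec; exists t; intros A f _; reflexivity. Qed.

Let canon_eq s t : eqv s t -> canon s = canon t.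
Proof.
intro E; unfold canon.
assert (P : eqv s = eqv t).
{ apply functional_extensionality; intro u; apply propositional_extensionality.
  split; intros H A f VA; [rewrite <- (E A f VA) | rewrite (E A f VA)]; auto. }
rewrite P; apply epsilon_inh_irrelevance.
exists t; intros A f _; reflexivity.
Qed.

Let free_carrier : Type := { t : term X | canon t = t }.

Let cls (t : term X) : free_carrier :=
  exist (fun u => canon u = u) (canon t)
    (canon_eq (fun A f VA => eq_sym (canonP t f VA))).

Let cls_eq s t : eqv s t -> cls s = cls t.
Proof.
intro E; apply eq_sig_hprop; [intros; apply proof_irrelevance |].
exact (canon_eq E).
Qed.

Let cls_proj (a : free_carrier) : cls (proj1_sig a) = a.
Proof.
apply eq_sig_hprop; [intros; apply proof_irrelevance |]; exact (proj2_sig a).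
Qed.

Definition free_algebra : algebra :=
  {| carrier := free_carrier;
     mul  := fun a b => cls (tmul (proj1_sig a) (proj1_sig b));
     star := fun a => cls (tstar (proj1_sig a));
     plus := fun a => cls (tplus (proj1_sig a));
     maxi := fun a => cls (tmaxi (proj1_sig a));
     one  := cls tone |}.

Definition free_gen (x : X) : free_algebra := cls (tvar x).

Let to (A : algebra) (f : X -> A) (a : free_algebra) : A := value f (proj1_sig a).

Let to_cls (A : algebra) (f : X -> A) t : V A -> value f (canon t) = value f t.
Proof. intro VA; symmetry; exact (canonP t f VA). Qed.

Let to_morph (A : algebra) (f : X -> A) : V A -> morphism (to f).
Proof.
intro VA; split; intros; unfold to; cbn; now rewrite (to_cls _ _ VA).
Qed.

Let separated (a b : free_algebra) :
  (forall (A : algebra) (f : X -> A), V A -> to f a = to f b) -> a = b.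
Proof.
intro H; rewrite <- (cls_proj a), <- (cls_proj b); apply cls_eq.
intros A f VA; exact (H A f VA).
Qed.

Let free_in_class_is_free : V free_algebra -> is_free V free_gen.
Proof.
intro VF; split; [exact VF |]; intros A f VA.
exists (to f); split; [split; [exact (to_morph f VA) |] |].
- intro x; exact (to_cls f (tvar x) VA).
- intros h' Hh' E a.
  assert (G : forall t, h' (cls t) = value f t).
  { assert (D : forall t, cls t = value free_gen t).
    { induction t as [x| |u IHu v IHv|u IHu|u IHu|u IHu]; cbn;
        try reflexivity; rewrite <- ?IHu, <- ?IHv; cbn; apply cls_eq;
        intros B g VB; cbn; now rewrite !(to_cls _ _ VB). }
    intro t; rewrite D; clear D.
    induction t as [x| |u IHu v IHv|u IHu|u IHu|u IHu]; cbn [value];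
      [apply E | apply (morph_one Hh') | rewrite (morph_mul Hh')
      | rewrite (morph_star Hh') | rewrite (morph_plus Hh')
      | rewrite (morph_maxi Hh')]; now rewrite ?IHu, ?IHv. }
  rewrite <- (cls_proj a) at 1; apply G.
Qed.

Hypothesis VF : forall A, V A -> F_birestriction_monoid A.

Ltac by_separation :=
  intros; apply separated; intros ? ? VA;
  pose proof (VF VA) as HF; pose proof (proj1 HF) as HB;
  repeat first [ rewrite (morph_mul (to_morph _ VA))
               | rewrite (morph_star (to_morph _ VA))
               | rewrite (morph_plus (to_morph _ VA))
               | rewrite (morph_maxi (to_morph _ VA))
               | rewrite (morph_one (to_morph _ VA)) ].

Let free_F_birestriction : F_birestriction_monoid free_algebra.
Proof.
apply F_birestriction_of_identities.
- split; by_separation; apply HB.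
- by_separation; apply (maxi_plus HF).
- by_separation; apply (maxi_starr HF).
Qed.

Let free_left : (forall A, V A -> left_strong_identity A) ->
  left_strong_identity free_algebra.
Proof. intros H x y; by_separation; apply (H _ VA). Qed.

Let free_right : (forall A, V A -> right_strong_identity A) ->
  right_strong_identity free_algebra.
Proof. intros H x y; by_separation; apply (H _ VA). Qed.

Lemma free_algebra_is_free :
  (F_birestriction_monoid free_algebra ->
   ((forall A, V A -> left_strong_identity A) ->
      left_strong_identity free_algebra) ->
   ((forall A, V A -> right_strong_identity A) ->
      right_strong_identity free_algebra) -> V free_algebra) ->
  is_free V free_gen.
Proof. intro H; apply free_in_class_is_free; apply H; auto. Qed.

End Free.

Lemma free_exists (X : Type) :
  is_free left_strong (@free_gen left_strong X) /\
  is_free right_strong (@free_gen right_strong X) /\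
  is_free strong (@free_gen strong X).
Proof.
split; [| split]; apply free_algebra_is_free;
  try (intros A VA; apply VA); intros HF HL HR.
- split; [exact HF |]; apply HL; intros A VA; apply VA.
- split; [exact HF |]; apply HR; intros A VA; apply VA.
- split; [exact HF | split; [apply HL | apply HR]]; intros A VA; apply VA.
Qed.

(* Main.v *)
(** In an F-birestriction monoid every element is [x = x^+ x^m], so two terms agree as
    soon as they have the same word and their projections [s^+], [t^+] lie below each
    other.  The maximum elements act by partial bijections on the projections, the word
    [uv] extending the composite of [u] and [v]; conversely any set with such partial
    bijections (a graph closed under a few edge-adding rules) defines an
    F-birestriction monoid, strong on a side when the matching rule holds.  Hence
    [s^+ <= t^+] iff [t] can be read from the origin in the closure of the linear graph of
    [s] (its Schützenberger graph).  Edges respect a height function and involve only the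
    letters of [s], so the closure is finite and is found by adding edges until nothing
    changes. *)

From Stdlib Require Import FunctionalExtensionality PropExtensionality.
From Stdlib Require Import ProofIrrelevance ClassicalEpsilon.
From Stdlib Require Import List Bool ZArith Lia.
Require Import Defs.
Import ListNotations.

Local Notation "x * y" := (mul x y) : alg_scope.
Local Notation "x ^*" := (star x) (at level 2, left associativity, format "x ^*") : alg_scope.
Local Notation "x ^+" := (plus x) (at level 2, left associativity, format "x ^+") : alg_scope.
Local Notation "x ^m" := (maxi x) (at level 2, left associativity, format "x ^m") : alg_scope.

(** * Birestriction monoids *)

(** Saturation can work on a fixed vertex set because a strong identity speaks of a triangle of
    edges labelled [u], [v] and [u ++ v]: each rule supplies a third side once two are present,
    between vertices that already exist. Labels could still grow along a directed cycle with a
    non-empty label; the height function excludes such cycles, as it fixes the length of a label by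
    its two ends. No bound on the number of rounds is ever computed: a program only has to recognise
    a state where nothing changes, while the fact that it is reached may come from a classical
    argument. The two halves of the correctness proof meet in [dom], which describes domains in the
    algebra of a closed graph and, in the graph of projections, the relation [e <= t^+]. A term is
    moreover read as a path, so that it has a linear graph to start from and so that membership in
    [dom] can be searched for step by step. *)

Section Birestriction.
Local Open Scope alg_scope.
Context {S : algebra} (HB : birestriction_monoid S).

Lemma plus_idem (x : S) : (x^+)^+ = x^+.
Proof. now rewrite <- (br_plus_star HB x), (br_star_plus HB), (br_plus_star HB). Qed.

Lemma proj_star (e : S) : e^+ = e -> e^* = e.
Proof. intro E; rewrite <- E; apply (br_plus_star HB). Qed.

Lemma plus_plus (x : S) : x^+ * x^+ = x^+.
Proof. now rewrite <- (br_plusM HB), (br_plusL HB). Qed.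

(** [x^* y = y (xy)^*], and [(xy)^*] already lies below [y^*]. *)
Lemma star_mul (x y : S) : (x * y)^* = (x^* * y)^*.
Proof.
rewrite (br_starL HB), (br_starM HB), (br_starC HB), <- (br_starM HB).
now rewrite <- (br_mulA HB), (br_starR HB).
Qed.

Lemma star_mul_le (x y : S) : (x * y)^* * y^* = (x * y)^*.
Proof. now rewrite <- (br_starM HB), <- (br_mulA HB), (br_starR HB). Qed.

Lemma plus_mul_le (x y : S) : x^+ * (x * y)^+ = (x * y)^+.
Proof. now rewrite <- (br_plusM HB), (br_mulA HB), (br_plusL HB). Qed.

Lemma plus_mul (x y : S) : (x * y)^+ = (x * y^+)^+.
Proof.
rewrite (br_plusR HB), (br_plusM HB), (br_plusC HB).
now rewrite plus_mul_le.
Qed.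

Lemma one_plus : (one : S)^+ = one.
Proof. now rewrite <- (br_mulx1 HB (one^+)), (br_plusL HB). Qed.

(** The natural order is two-sided: the axioms [br_starL] and [br_plusR] carry a projection across
    an element in either direction. *)
Lemma below_star (a m : S) : a = a^+ * m <-> a = m * a^*.
Proof.
split; intro E.
- rewrite E at 1. rewrite <- (br_plus_star HB a), (br_starL HB).
  now rewrite <- E.
- rewrite E at 1. rewrite <- (br_star_plus HB a), (br_plusR HB).
  now rewrite <- E.
Qed.

Lemma below_plus (a m : S) : a = a^+ * m -> a^+ * m^+ = a^+.
Proof. intro E. rewrite E at 2. now rewrite (br_plusM HB). Qed.

Lemma below_mul_star (a b : S) : a^* = b^+ -> (a * b)^+ = a^+ /\ (a * b)^* = b^*.
Proof.
intro E; split.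
- now rewrite plus_mul, <- E, (br_starR HB).
- now rewrite star_mul, E, (br_plusL HB).
Qed.

Lemma le_antisym (e f : S) : e^+ * f^+ = e^+ -> f^+ * e^+ = f^+ -> e^+ = f^+.
Proof. intros E1 E2; now rewrite <- E1, (br_plusC HB). Qed.

(** Reversing products exchanges the two strong identities, so that right-handed facts follow from
    left-handed ones. *)
Definition opp : algebra :=
  {| carrier := S; mul := fun x y => y * x; star := @plus S; plus := @star S;
     maxi := @maxi S; one := one |}.

Lemma opp_birestriction : birestriction_monoid opp.
Proof.
split; cbn; intros; try apply HB; symmetry; apply HB.
Qed.

End Birestriction.
Arguments opp : clear implicits.

(** * F-birestriction monoids and their maximum elements *)

Section FBirestriction.
Local Open Scope alg_scope.
Context {S : algebra} (HF : F_birestriction_monoid S).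
Let HB : birestriction_monoid S := proj1 HF.

Lemma maxi_star (x : S) : x = x^m * x^*.
Proof. apply (below_star HB), (maxi_plus HF). Qed.

Lemma maxi_plusl (x y : S) : (x^+ * y)^m = y^m.
Proof. rewrite <- (br_plus_star HB x), (br_starL HB). apply (maxi_starr HF). Qed.

Lemma maxi_idem (x : S) : (x^m)^m = x^m.
Proof. rewrite (maxi_plus HF x) at 2. now rewrite maxi_plusl. Qed.

(** In [x^+ x^m y^m y^*] only outer projections have been added to [x^m y^m], and these do not
    change the maximum. *)
Lemma maxi_mul (x y : S) : (x * y)^m = (x^m * y^m)^m.
Proof.
rewrite (maxi_plus HF x) at 1; rewrite (maxi_star y) at 1.
rewrite <- (br_mulA HB), maxi_plusl, (br_mulA HB). apply (maxi_starr HF).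
Qed.

Lemma one_maxi : (one : S)^m = one.
Proof.
rewrite (maxi_plus HF one) at 2. now rewrite (one_plus HB), (br_mul1x HB).
Qed.

Lemma star_maxi (x : S) : (x^*)^m = one.
Proof.
rewrite <- (br_mul1x HB (x^*)), (maxi_starr HF). exact one_maxi.
Qed.

Lemma plus_maxi (x : S) : (x^+)^m = one.
Proof. rewrite <- (br_plus_star HB). apply star_maxi. Qed.

Lemma below_maxi (a x : S) : a = a^+ * x^m -> a^m = x^m.
Proof. intro E; rewrite E, maxi_plusl; apply maxi_idem. Qed.

Lemma opp_F_birestriction : F_birestriction_monoid (opp S).
Proof.
apply F_birestriction_of_identities.
- exact (opp_birestriction HB).
- exact maxi_star.
- intros x y; exact (maxi_plusl y x).
Qed.

Lemma below_comp (x y a b : S) :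
  a = a^+ * x^m -> b = b^+ * y^m -> a * b = (a * b)^+ * (x * y)^m.
Proof.
intros Ea Eb. rewrite (maxi_mul x y), <- (below_maxi _ _ Ea), <- (below_maxi _ _ Eb).
rewrite <- maxi_mul. apply (maxi_plus HF).
Qed.

(** The identity at [x], [y] gives [a y^m = c]. Then [a (y^m)^+ = c^+ a = a], so [a^*] lies below
    [(y^m)^+], and [y^m] restricted to [a^*] is the missing side of the triangle. *)
Lemma below_left (x y a c : S) :
  x^m * y^m = (x^m)^+ * (x * y)^m ->
  a = a^+ * x^m -> c = c^+ * (x * y)^m -> a^+ = c^+ ->
  exists b, b = b^+ * y^m /\ b^+ = a^* /\ b^* = c^*.
Proof.
intros H Ea Ec E.
assert (Eac : a * y^m = c).
{ rewrite Ea, <- (br_mulA HB), H, (br_mulA HB), (below_plus HB _ _ Ea), E.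
  now symmetry. }
assert (Eb : (a^* * y^m)^+ = a^*).
{ assert (E1 : a * (y^m)^+ = a).
  { now rewrite (br_plusR HB), Eac, <- E, (br_plusL HB). }
  rewrite <- (br_star_plus HB a), (br_plusM HB), (br_star_plus HB a).
  rewrite <- (br_plus_star HB (y^m)), <- (br_starM HB), (br_plus_star HB (y^m)).
  now rewrite E1. }
exists (a^* * y^m); repeat split.
- now rewrite Eb.
- exact Eb.
- now rewrite <- (star_mul HB), Eac.
Qed.

End FBirestriction.

(** This is [below_left] in the opposite monoid, where [x] and [y] change places; [below_star]
    translates the order conditions. *)
Lemma below_right (S : algebra) (HF : F_birestriction_monoid S) (x y a c : S) :
  (mul (maxi x) (maxi y) = mul (maxi (mul x y)) (star (maxi y))) ->
  a = mul (plus a) (maxi y) -> c = mul (plus c) (maxi (mul x y)) ->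
  star a = star c ->
  exists b, b = mul (plus b) (maxi x) /\ star b = plus a /\ plus b = plus c.
Proof.
intros H Ea Ec E.
destruct (@below_left (opp S) (opp_F_birestriction HF) y x a c H) as (b & Eb & ?).
- now apply (below_star (proj1 HF)) in Ea.
- now apply (below_star (proj1 HF)) in Ec.
- exact E.
- exists b; split; [now apply (below_star (proj1 HF)) | assumption].
Qed.
(** * Closed graphs *)

(** Edges labelled by a word [w] stand for the maximum element over [w]; edges labelled
    by the empty word play the role of equality of vertices, so that folding a graph
    amounts to adding edges.  [mark [x] p] says that the letter [x] itself, and not
    only the maximum element above it, is defined at [p]. *)
Record graph (X : Type) : Type := Graph {
  vertex : Type;
  edge : vertex -> list X -> vertex -> Prop;
  mark : list X -> vertex -> Prop
}.
Arguments vertex {X}. Arguments edge {X}. Arguments mark {X}.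

(** With [v = []] (resp. [u = []]) the last two rules express determinism (resp.
    codeterminism); in general they express the left (resp. right) strong identity. *)
Record closed {X : Type} (l r : bool) (G : graph X) : Prop := {
  cl_comp : forall p q s u v,
    edge G p u q -> edge G q v s -> edge G p (u ++ v) s;
  cl_left : forall p q s u v, v = [] \/ l = true ->
    edge G p u q -> edge G p (u ++ v) s -> edge G q v s;
  cl_right : forall p q s u v, u = [] \/ r = true ->
    edge G p (u ++ v) s -> edge G q v s -> edge G p u q;
  cl_mark : forall p q w, edge G p [] q -> mark G w p -> mark G w q
}.

Arguments cl_comp {X l r G}. Arguments cl_left {X l r G}.
Arguments cl_right {X l r G}. Arguments cl_mark {X l r G}.

Fixpoint word {X : Type} (t : term X) : list X :=
  match t with
  | tvar x => [x]
  | tmul u v => word u ++ word v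
  | tmaxi u => word u
  | _ => []
  end.

(** The vertices at which [t] can be applied; it then leads along an edge [word t]. *)
Fixpoint dom {X : Type} (G : graph X) (t : term X) (p : vertex G) : Prop :=
  match t with
  | tvar x => mark G [x] p /\ exists q, edge G p [x] q
  | tone => edge G p [] p
  | tmul u v => dom G u p /\ exists q, edge G p (word u) q /\ dom G v q
  | tstar u => exists q, dom G u q /\ edge G q (word u) p
  | tplus u => dom G u p
  | tmaxi u => exists q, edge G p (word u) q
  end.

Section Closed.
Context {X : Type} {l r : bool} {G : graph X} (HG : closed l r G).
Implicit Types p q s : vertex G.

Lemma edge_det p q s u : edge G p u q -> edge G p u s -> edge G q [] s.
Proof.
intros H1 H2; apply (cl_left HG p q s u []); auto; now rewrite app_nil_r.
Qed.

Lemma edge_codet p q s u : edge G p u s -> edge G q u s -> edge G p [] q.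
Proof. intros H1 H2; apply (cl_right HG p q s [] u); auto. Qed.

(** Codeterminism puts a loop at [p], and determinism, applied to it and to the given edge, reverses
    that edge. Empty edges thus form a partial equivalence, reflexive only at vertices that meet
    some edge. *)
Lemma edge_sym p q : edge G p [] q -> edge G q [] p.
Proof. intro H; apply (edge_det p _ _ []); [exact H |]; exact (edge_codet _ _ _ _ H H). Qed.

Lemma edge_source p q u : edge G p u q -> edge G p [] p.
Proof. intro H; exact (edge_codet _ _ _ _ H H). Qed.

Lemma edge_target p q u : edge G p u q -> edge G q [] q.
Proof. intro H; exact (edge_det _ _ _ _ H H). Qed.

Lemma edge_congl p q s u : edge G p [] q -> edge G q u s -> edge G p u s.
Proof. exact (cl_comp HG p q s [] u). Qed.

Lemma edge_congr p q s u : edge G p u q -> edge G q [] s -> edge G p u s.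
Proof. rewrite <- (app_nil_r u) at 2; exact (cl_comp HG p q s u []). Qed.

Lemma dom_edge t p : dom G t p -> exists q, edge G p (word t) q.
Proof.
revert p; induction t as [x| |u IHu v IHv|u IHu|u IHu|u IHu]; cbn; intro p.
- tauto.
- eauto.
- intros [_ [q [E D]]]; destruct (IHv _ D) as [s F].
  exists s; exact (cl_comp HG _ _ _ _ _ E F).
- intros [q [_ E]]; exists p; exact (edge_target _ _ _ E).
- intro D; destruct (IHu _ D) as [q E]; exists p; exact (edge_source _ _ _ E).
- auto.
Qed.

Lemma dom_cong t p q : edge G p [] q -> dom G t p -> dom G t q.
Proof.
revert p q; induction t as [x| |u IHu v IHv|u IHu|u IHu|u IHu]; cbn; intros p q E.
- intros [D [s F]]; split; [exact (cl_mark HG _ _ _ E D) |].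
  exists s; exact (edge_congl _ _ _ _ (edge_sym _ _ E) F).
- intros _; exact (edge_target _ _ _ E).
- intros [D [s [F D']]]; split; [exact (IHu _ _ E D) |].
  exists s; split; [| exact D']; exact (edge_congl _ _ _ _ (edge_sym _ _ E) F).
- intros [s [D F]]; exists s; split; [exact D |]; exact (edge_congr _ _ _ _ F E).
- exact (IHu _ _ E).
- intros [s F]; exists s; exact (edge_congl _ _ _ _ (edge_sym _ _ E) F).
Qed.

End Closed.

(** A step of a path: its direction ([true] for forwards), whether it is labelled by a
    letter or by a maximum element, and its word. *)
Definition step (X : Type) : Type := (bool * (bool * list X))%type.

Definition inv {X : Type} (w : list (step X)) : list (step X) :=
  rev (map (fun a => (negb (fst a), snd a)) w).

(** The image of [t] in the universal inverse monoid, where [x^+ = x x^-1] and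
    [x^* = x^-1 x]. *)
Fixpoint path {X : Type} (t : term X) : list (step X) :=
  match t with
  | tvar x => [(true, (true, [x]))]
  | tone => []
  | tmul u v => path u ++ path v
  | tstar u => inv (path u) ++ path u
  | tplus u => path u ++ inv (path u)
  | tmaxi u => [(true, (false, word u))]
  end.

Definition traverse {X : Type} (G : graph X) (a : step X) (p q : vertex G) : Prop :=
  let '(p, q) := if fst a then (p, q) else (q, p) in
  edge G p (snd (snd a)) q /\
  (fst (snd a) = true -> mark G (snd (snd a)) p).

Fixpoint walk {X : Type} (G : graph X) (w : list (step X)) (p q : vertex G) : Prop :=
  match w with
  | [] => edge G p [] q
  | a :: w => exists s, traverse G a p s /\ walk G w s q
  end.

Section Walks.
Context {X : Type} {l r : bool} {G : graph X} (HG : closed l r G).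
Implicit Types p q s : vertex G.

Lemma traverse_source a p q : traverse G a p q -> edge G p [] p.
Proof.
destruct a as [[] [b u]]; cbn; intros [E _];
  [exact (edge_source HG _ _ _ E) | exact (edge_target HG _ _ _ E)].
Qed.

Lemma traverse_target a p q : traverse G a p q -> edge G q [] q.
Proof.
destruct a as [[] [b u]]; cbn; intros [E _];
  [exact (edge_target HG _ _ _ E) | exact (edge_source HG _ _ _ E)].
Qed.

Lemma traverse_cong a p q s : edge G p [] q -> traverse G a p s -> traverse G a q s.
Proof.
destruct a as [[] [b u]]; cbn; intros E [F D]; split.
- exact (edge_congl HG _ _ _ _ (edge_sym HG _ _ E) F).
- intro H; exact (cl_mark HG _ _ _ E (D H)).
- exact (edge_congr HG _ _ _ _ F E).
- exact D.
Qed.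

Lemma walk_cong w p q s : edge G p [] q -> walk G w p s -> walk G w q s.
Proof.
destruct w as [|a w]; cbn; intro E.
- intro F; exact (edge_congl HG _ _ _ _ (edge_sym HG _ _ E) F).
- intros [s' [F W]]; exists s'; split; [exact (traverse_cong _ _ _ _ E F) | exact W].
Qed.

Lemma walk_source w p q : walk G w p q -> edge G p [] p.
Proof.
destruct w as [|a w]; cbn.
- apply (edge_source HG).
- intros [s [F _]]; exact (traverse_source _ _ _ F).
Qed.

Lemma walk_app w w' p q :
  walk G (w ++ w') p q <-> exists s, walk G w p s /\ walk G w' s q.
Proof.
revert p; induction w as [|a w IH]; cbn; intro p; split.
- intro W; exists p; split; [exact (walk_source _ _ _ W) | exact W].
- intros [s [E W]]; exact (walk_cong _ _ _ _ (edge_sym HG _ _ E) W).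
- intros [s [F W]]; apply IH in W; destruct W as [s' [W W']].
  exists s'; split; [exists s |]; auto.
- intros [s' [[s [F W]] W']]; exists s; split; [exact F |]; apply IH; eauto.
Qed.

Lemma walk_single a p q : walk G [a] p q <-> traverse G a p q.
Proof.
split.
- cbn; intros [s [F E]]; destruct a as [[] [b u]]; cbn in *; destruct F as [F D].
  + split; [exact (edge_congr HG _ _ _ _ F E) | exact D].
  + split; [exact (edge_congl HG _ _ _ _ (edge_sym HG _ _ E) F) |].
    intro H; exact (cl_mark HG _ _ _ E (D H)).
- intro F; exists q; split; [exact F | exact (traverse_target _ _ _ F)].
Qed.

Lemma walk_inv w p q : walk G (inv w) p q <-> walk G w q p.
Proof.
revert p q; induction w as [|a w IH]; intros p q.
- split; apply (edge_sym HG).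
- unfold inv; cbn [map rev]; rewrite walk_app.
  assert (flip : forall s, walk G [(negb (fst a), snd a)] s q <-> traverse G a q s).
  { intro s; rewrite walk_single; destruct a as [[] [b u]]; reflexivity. }
  cbn [walk]; split; intros [s [W1 W2]]; exists s; split.
  + now apply flip.
  + now apply IH.
  + now apply IH.
  + now apply flip.
Qed.

(** Going along [u] and back ends where it began, up to an empty edge: by codeterminism for [tplus],
    by determinism for [tstar], where the way back comes first. *)
Lemma walk_path t p q : walk G (path t) p q <-> dom G t p /\ edge G p (word t) q.
Proof.
revert p q; induction t as [x| |u IHu v IHv|u IHu|u IHu|u IHu]; intros p q;
  cbn [path dom word].
- rewrite walk_single; cbn; firstorder.
- cbn; split; [| tauto]; intro E; split; [exact (edge_source HG _ _ _ E) | exact E].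
- rewrite walk_app; split.
  + intros [s [W1 W2]]; apply IHu in W1; apply IHv in W2.
    destruct W1 as [D1 E1], W2 as [D2 E2]; split; [split; eauto |].
    exact (cl_comp HG _ _ _ _ _ E1 E2).
  + intros [[D1 [s [E1 D2]]] E2]; exists s; split; [now apply IHu |]; apply IHv.
    split; [exact D2 |]; destruct (dom_edge HG _ _ D2) as [q' E'].
    refine (edge_congr HG _ _ _ _ E' _).
    exact (edge_det HG _ _ _ _ (cl_comp HG _ _ _ _ _ E1 E') E2).
- rewrite walk_app; split.
  + intros [s [W1 W2]]; apply walk_inv, IHu in W1; apply IHu in W2; split; [exists s; tauto |].
    exact (edge_det HG _ _ _ _ (proj2 W1) (proj2 W2)).
  + intros [[s [D E]] F]; exists s; rewrite walk_inv, !IHu.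
    repeat split; auto; exact (edge_congr HG _ _ _ _ E F).
- rewrite walk_app; split.
  + intros [s [W1 W2]]; apply walk_inv, IHu in W2; apply IHu in W1; split; [tauto |].
    exact (edge_codet HG _ _ _ _ (proj2 W1) (proj2 W2)).
  + intros [D F]; destruct (dom_edge HG _ _ D) as [s E]; exists s.
    rewrite walk_inv, !IHu; repeat split; auto.
    * exact (dom_cong HG _ _ _ F D).
    * exact (edge_congl HG _ _ _ _ (edge_sym HG _ _ F) E).
- rewrite walk_single; cbn; split; [intros [E _]; eauto | intros [_ E]; easy].
Qed.

End Walks.

(** * The algebra of a closed graph *)

Definition in_class (l r : bool) (S : algebra) : Prop :=
  F_birestriction_monoid S /\ (l = true -> left_strong_identity S) /\
  (r = true -> right_strong_identity S).

Section Model.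
Context {X : Type} {l r : bool} {G : graph X} (HG : closed l r G).
Implicit Types p q s : vertex G.

(** [(D, w)] is the restriction to [D] of the partial bijection defined by the edges
    labelled [w]. *)
Definition admissible (a : (vertex G -> Prop) * list X) : Prop :=
  (forall p, fst a p -> exists q, edge G p (snd a) q) /\
  (forall p q, edge G p [] q -> fst a p -> fst a q).

Definition restriction : Type := { a | admissible a }.

Definition domain (a : restriction) : vertex G -> Prop := fst (proj1_sig a).
Definition label (a : restriction) : list X := snd (proj1_sig a).

Lemma restriction_eq (a b : restriction) :
  label a = label b -> (forall p, domain a p <-> domain b p) -> a = b.
Proof.
intros E H; apply eq_sig_hprop; [intros; apply proof_irrelevance |].
destruct a as [[D w] ?], b as [[D' w'] ?]; cbn in *; f_equal; [| exact E].
apply functional_extensionality; intro p; apply propositional_extensionality, H.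
Qed.

Lemma domain_edge (a : restriction) p : domain a p -> exists q, edge G p (label a) q.
Proof. apply (proj2_sig a). Qed.

Lemma domain_cong (a : restriction) p q : edge G p [] q -> domain a p -> domain a q.
Proof. apply (proj2_sig a). Qed.

Lemma res_mul_subproof (a b : restriction) :
  admissible (fun p => domain a p /\ exists q, edge G p (label a) q /\ domain b q,
              label a ++ label b).
Proof.
split; cbn.
- intros p [_ [q [E D]]]; destruct (domain_edge _ _ D) as [s F].
  exists s; exact (cl_comp HG _ _ _ _ _ E F).
- intros p q F [D [s [E D']]]; split; [exact (domain_cong _ _ _ F D) |].
  exists s; split; [| exact D']; exact (edge_congl HG _ _ _ _ (edge_sym HG _ _ F) E).
Qed.

Lemma res_star_subproof (a : restriction) :
  admissible (fun p => exists q, domain a q /\ edge G q (label a) p, []).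
Proof.
split; cbn.
- intros p [q [_ E]]; exists p; exact (edge_target HG _ _ _ E).
- intros p q F [s [D E]]; exists s; split; [exact D | exact (edge_congr HG _ _ _ _ E F)].
Qed.

Lemma res_plus_subproof (a : restriction) : admissible (domain a, []).
Proof.
split; cbn; [| exact (domain_cong a)].
intros p D; destruct (domain_edge _ _ D) as [q E].
exists p; exact (edge_source HG _ _ _ E).
Qed.

Lemma res_maxi_subproof (w : list X) : admissible (fun p => exists q, edge G p w q, w).
Proof.
split; cbn; [auto |]; intros p q F [s E]; exists s.
exact (edge_congl HG _ _ _ _ (edge_sym HG _ _ F) E).
Qed.

(** Partial bijections that agree but carry different words stay distinct: the maximum consists of
    all edges over the word and cannot be recovered from a restriction. *)
Definition model : algebra :=
  {| carrier := restriction;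
     mul := fun a b => exist _ _ (res_mul_subproof a b);
     star := fun a => exist _ _ (res_star_subproof a);
     plus := fun a => exist _ _ (res_plus_subproof a);
     maxi := fun a => exist _ _ (res_maxi_subproof (label a));
     one := exist _ _ (res_maxi_subproof []) |}.

Ltac model_eq :=
  intros; apply restriction_eq; cbn;
  [now rewrite ?app_nil_r, ?app_assoc | intro p; split].

Lemma model_birestriction : birestriction_monoid model.
Proof.
split.
- model_eq.
  + intros [D [q [E [D' [s [F D'']]]]]]; split; [split; eauto |].
    exists s; split; [exact (cl_comp HG _ _ _ _ _ E F) | exact D''].
  + intros [[D [q [E D']]] [s [F D'']]]; split; [exact D |]; exists q.
    split; [exact E |]; split; [exact D' |].
    destruct (domain_edge _ _ D') as [s' F']; exists s'; split; [exact F' |].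
    refine (domain_cong _ _ _ _ D'').
    exact (edge_det HG _ _ _ _ F (cl_comp HG _ _ _ _ _ E F')).
- model_eq.
  + intros [_ [q [E D]]]; exact (domain_cong _ _ _ (edge_sym HG _ _ E) D).
  + intro D; destruct (domain_edge _ _ D) as [q E].
    pose proof (edge_source HG _ _ _ E); eauto.
- model_eq; [tauto |].
  intro D; split; [exact D |]; destruct (domain_edge _ _ D) as [q E].
  exists q; split; [exact E |]; exists q; exact (edge_target HG _ _ _ E).
- model_eq; [tauto |].
  intro D; split; [exact D |]; destruct (domain_edge _ _ D) as [q E]; eauto.
- model_eq.
  + intros [[q [D E]] [s [F [s' [D' E']]]]].
    pose proof (edge_sym HG _ _ F) as F'.
    split; [exists s'; split; [exact D' | exact (edge_congr HG _ _ _ _ E' F')] |].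
    exists s; split; [exact F |]; exists q; split; [exact D |].
    exact (edge_congr HG _ _ _ _ E F).
  + intros [[q [D E]] [s [F [s' [D' E']]]]].
    pose proof (edge_sym HG _ _ F) as F'.
    split; [exists s'; split; [exact D' | exact (edge_congr HG _ _ _ _ E' F')] |].
    exists s; split; [exact F |]; exists q; split; [exact D |].
    exact (edge_congr HG _ _ _ _ E F).
- model_eq.
  + intros [q [[D [s [E [s' [D' E']]]]] F]]; rewrite app_nil_r in F.
    pose proof (edge_det HG _ _ _ _ E F) as H.
    split; [eauto |]; exists p; split; [exact (edge_target HG _ _ _ F) |].
    exists s'; split; [exact D' | exact (edge_congr HG _ _ _ _ E' H)].
  + intros [[q [D E]] [s [F [s' [D' E']]]]]; exists q; rewrite app_nil_r.
    split; [| exact E]; split; [exact D |]; exists p; split; [exact E |].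
    exists s'; split; [exact D' |].
    exact (edge_congr HG _ _ _ _ E' (edge_sym HG _ _ F)).
- model_eq.
  + intros [[q [D E]] [s [F D']]].
    pose proof (domain_cong _ _ _ (edge_sym HG _ _ F) D') as D''.
    split; [exact D'' |]; destruct (domain_edge _ _ D'') as [s' F'].
    exists s'; split; [exact F' |]; exists q; split; [eauto |].
    exact (cl_comp HG _ _ _ _ _ E F').
  + intros [D [q [E [s [[D' [s' [F D'']]] F']]]]].
    destruct (domain_edge _ _ D'') as [q' E'].
    pose proof (edge_det HG _ _ _ _ (cl_comp HG _ _ _ _ _ F E') F') as H.
    (* [s'] and [p] both lead to [q] along [label y], so codeterminism joins them by an empty
       edge. *)
    pose proof (edge_codet HG _ _ _ _ (edge_congr HG _ _ _ _ E' H) E) as H'.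
    split; [exists s; split; [exact D' | exact (edge_congr HG _ _ _ _ F H')] |].
    exists p; split; [exact (edge_source HG _ _ _ E) | exact D].
- model_eq; [tauto |].
  intro D; split; [exact D |]; destruct (domain_edge _ _ D) as [q E].
  exists p; split; [exact (edge_source HG _ _ _ E) | exact D].
- model_eq; intros [D [q [E D']]]; pose proof (edge_sym HG _ _ E) as F;
    (split; [exact (domain_cong _ _ _ F D') |]; exists q;
     split; [exact E | exact (domain_cong _ _ _ E D)]).
- model_eq; tauto.
- model_eq.
  + intros [D [q [E D']]]; split; [eauto |].
    exists p; split; [exact (edge_source HG _ _ _ E) | exact D].
  + tauto.
- model_eq.
  + intros [q [D E]]; exact (domain_cong _ _ _ E D).
  + intro D; destruct (domain_edge _ _ D) as [q E].
    exists p; split; [exact D | exact (edge_source HG _ _ _ E)].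
- model_eq; tauto.
Qed.

Lemma model_F_birestriction : F_birestriction_monoid model.
Proof.
apply F_birestriction_of_identities; [exact model_birestriction | |].
- model_eq; [| tauto].
  intro D; split; [exact D |]; destruct (domain_edge _ _ D) as [q E].
  exists p; split; [exact (edge_source HG _ _ _ E) | eauto].
- model_eq; rewrite app_nil_r; tauto.
Qed.

(** In each identity the words agree and composition gives one inclusion of domains; the other is
    exactly [cl_left], respectively [cl_right]. *)
Lemma model_in_class : in_class l r model.
Proof.
split; [exact model_F_birestriction |]; split; intro b.
- intros x y; model_eq.
  + intros [D [q [E [s F]]]]; split; [exact D |].
    exists p; split; [exact (edge_source HG _ _ _ E) |].
    exists s; exact (cl_comp HG _ _ _ _ _ E F).
  + intros [[q E] [p' [F [s E']]]]; split; [eauto |].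
    exists q; split; [exact E |]; exists s.
    apply (cl_left HG p q s (label x) (label y)); auto.
    exact (edge_congl HG _ _ _ _ F E').
- intros x y; model_eq.
  + intros [D [q [E [s F]]]]; pose proof (cl_comp HG _ _ _ _ _ E F) as H.
    split; [eauto |]; exists s; split; [exact H |]; exists q; split; [eauto | exact F].
  + intros [_ [q [E [s [_ F]]]]].
    pose proof (cl_right HG _ _ _ _ _ (or_intror b) E F) as H.
    split; [eauto |]; exists s; split; [exact H | eauto].
Qed.

Lemma gen_subproof (x : X) :
  admissible (fun p => mark G [x] p /\ exists q, edge G p [x] q, [x]).
Proof.
split; cbn; [tauto |]; intros p q F [D [s E]]; split; [exact (cl_mark HG _ _ _ F D) |].
exists s; exact (edge_congl HG _ _ _ _ (edge_sym HG _ _ F) E).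
Qed.

Definition model_gen (x : X) : model := exist _ _ (gen_subproof x).

Lemma label_value (t : term X) : label (value model_gen t) = word t.
Proof. induction t; cbn; auto; unfold label in *; cbn; congruence. Qed.

Lemma domain_value (t : term X) p : domain (value model_gen t) p <-> dom G t p.
Proof.
revert p; induction t as [x| |u IHu v IHv|u IHu|u IHu|u IHu]; intro p;
  cbn [value dom]; rewrite <- ?label_value; cbn.
- reflexivity.
- split; [intros [q E]; exact (edge_source HG _ _ _ E) | eauto].
- rewrite IHu; split; intros [D [q [E D']]]; split; auto; exists q; split; auto;
    now apply IHv.
- split; intros [q [D E]]; exists q; split; auto; now apply IHu.
- apply IHu.
- reflexivity.
Qed.

End Model.

(** * The action of an algebra on its projections *)

Section Projections.
Local Open Scope alg_scope.
Context {X : Type} {l r : bool} {S : algebra} (HS : in_class l r S) (f : X -> S).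
Let HF : F_birestriction_monoid S := proj1 HS.
Let HB : birestriction_monoid S := proj1 HF.

Definition word_value (w : list X) : S := fold_right (fun x y => f x * y) one w.

Lemma word_value_app u v : word_value (u ++ v) = word_value u * word_value v.
Proof.
unfold word_value; induction u as [|x u IH]; cbn; [now rewrite (br_mul1x HB) |].
now rewrite IH, (br_mulA HB).
Qed.

(** Projections have maximum [one], so whatever stands under [tstar] or [tplus] leaves no letter in
    the maximum. *)
Lemma value_maxi (t : term X) : (value f t)^m = (word_value (word t))^m.
Proof.
induction t as [x| |u IHu v IHv|u IHu|u IHu|u IHu]; cbn.
- now rewrite (br_mulx1 HB).
- reflexivity.
- now rewrite (maxi_mul HF), IHu, IHv, <- (maxi_mul HF), word_value_app.
- now rewrite (star_maxi HF), (one_maxi HF).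
- now rewrite (plus_maxi HF), (one_maxi HF).
- now rewrite (maxi_idem HF).
Qed.

(** An element [a] below a maximum is drawn as an arrow from [a^+] to [a^*], so that composing edges
    is multiplying elements. Elements that are not projections are isolated vertices. *)
Definition projection_graph : graph X :=
  {| vertex := S;
     edge := fun e w e' =>
       exists a, a = a^+ * (word_value w)^m /\ a^+ = e /\ a^* = e';
     mark := fun w e => e^+ = e /\ e * (word_value w)^+ = e |}.

Lemma projection_graph_refl e e' : edge projection_graph e [] e' -> e = e'.
Proof.
cbn; intros (a & E & <- & <-); rewrite (one_maxi HF), (br_mulx1 HB) in E.
now rewrite E at 2; rewrite (br_plus_star HB).
Qed.

Lemma projection_graph_closed : closed l r projection_graph.
Proof.
destruct (proj2 HS) as [HL HR]; split; cbn -[word_value].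
- intros p q s u v (a & Ea & <- & <-) (b & Eb & E & <-).
  exists (a * b); rewrite word_value_app.
  split; [exact (below_comp HF _ _ _ _ Ea Eb) | now apply (below_mul_star HB)].
- intros p q s u v H (a & Ea & <- & <-) (c & Ec & E & <-).
  rewrite word_value_app in Ec.
  apply (below_left HF (word_value u) (word_value v)); auto.
  (* For empty [v] the identity reads [x^m = (x^m)^+ x^m], true in every F-birestriction monoid;
     this is why determinism belongs to closedness for both values of [l]. *)
  destruct H as [->|H]; [| now apply HL]; cbn.
  now rewrite (one_maxi HF), !(br_mulx1 HB), (br_plusL HB).
- intros p q s u v H (c & Ec & <- & <-) (a & Ea & <- & E).
  rewrite word_value_app in Ec.
  destruct (below_right S HF (word_value u) (word_value v) a c) as (b & Eb & ? & ?);
    auto; [| exists b; auto].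
  destruct H as [->|H]; [| now apply HR]; cbn.
  now rewrite (one_maxi HF), !(br_mul1x HB), (br_starR HB).
- intros p q w E; now rewrite (projection_graph_refl _ _ E).
Qed.

(** Below [t^+], restricting [t] or the maximum over its word to [e] gives the same element, so [t]
    acts on [e] as the edge does. *)
Lemma edge_word (t : term X) (e e' : S) : e^+ = e -> e * (value f t)^+ = e ->
  (edge projection_graph e (word t) e' <-> e' = (e * value f t)^*).
Proof.
intros Pe E.
assert (Et : e * value f t = e * (word_value (word t))^m).
{ rewrite (maxi_plus HF (value f t)) at 1.
  now rewrite (br_mulA HB), E, value_maxi. }
assert (Ee : (e * value f t)^+ = e).
{ rewrite <- Pe at 1; now rewrite (br_plusM HB), Pe. }
cbn -[word_value]; split.
- intros (a & Ea & <- & <-); rewrite Et; now f_equal.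
- intros ->; exists (e * value f t); rewrite Ee; repeat split; auto.
Qed.

(** For a product, [e <= (uv)^+] splits into [e <= u^+] and [(eu)^* <= v^+]; the second part follows
    from [e u v^+ = (e u v)^+ e u = e u]. *)
Lemma dom_projection_graph (t : term X) (e : S) : e^+ = e ->
  (dom projection_graph t e <-> e * (value f t)^+ = e).
Proof.
revert e; induction t as [x| |u IHu v IHv|u IHu|u IHu|u IHu]; intros e Pe;
  cbn [dom value].
- cbn -[word_value]; replace (word_value [x]) with (f x)
    by (symmetry; apply (br_mulx1 HB)).
  split; [tauto |]; intro E; split; [auto |].
  destruct (edge_word (tvar x) e (e * f x)^* Pe E) as [_ H].
  destruct (H eq_refl) as (a & Ea & ?); exists (a^*), a; split; [| tauto].
  now cbn in Ea; rewrite (br_mulx1 HB) in Ea.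
- rewrite (one_plus HB), (br_mulx1 HB); split; [auto | intros _]; exists e.
  cbn; rewrite (one_maxi HF), (br_mulx1 HB), Pe, (proj_star HB e Pe); auto.
- rewrite (IHu _ Pe); split.
  + intros [D [q [E D']]]; apply (edge_word u e q Pe D) in E; subst q.
    apply IHv in D'; [| apply (br_star_plus HB)].
    assert (F : (e * (value f u * value f v))^+ = e).
    { rewrite (br_mulA HB), (plus_mul HB).
      rewrite <- (br_starR HB (e * value f u)), <- (br_mulA HB), D', (br_starR HB).
      rewrite <- Pe at 1; now rewrite (br_plusM HB), Pe. }
    rewrite <- Pe at 1; now rewrite <- (br_plusM HB), Pe.
  + intro E.
    assert (D : e * (value f u)^+ = e).
    { rewrite <- E at 1; rewrite <- (br_mulA HB), (br_plusC HB), (plus_mul_le HB).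
      exact E. }
    split; [exact D |]; exists (e * value f u)^*; split; [now apply edge_word |].
    apply IHv; [apply (br_star_plus HB) |].
    rewrite <- (br_plus_star HB (value f v)), <- (br_starM HB), (br_plus_star HB).
    rewrite (br_plusR HB), <- (br_mulA HB); f_equal.
    rewrite <- Pe at 1; rewrite (br_plusM HB), Pe.
    rewrite E, (br_mulA HB), <- Pe at 1; rewrite <- Pe at 2.
    now rewrite (plus_plus HB), Pe.
- rewrite (br_star_plus HB); split.
  + intros [q [D E]].
    assert (Pq : q^+ = q) by (destruct E as (a & _ & <- & _); apply (plus_idem HB)).
    apply (IHu _ Pq) in D; apply (edge_word u q e Pq D) in E; subst e.
    apply (star_mul_le HB).
  (* The source is the part of the domain of [u] that is sent below [e]: [(ue)^+ u = u e], whose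
     star is [u^* e = e]. *)
  + intro E; exists (value f u * e)^+.
    assert (D : (value f u * e)^+ * (value f u)^+ = (value f u * e)^+).
    { rewrite (br_plusC HB); apply (plus_mul_le HB). }
    split; [apply (IHu _ (plus_idem HB _)); exact D |].
    apply edge_word; [apply (plus_idem HB) | exact D |].
    pose proof (proj_star HB e Pe) as Se.
    rewrite <- (br_plusR HB), Pe, <- Se, (br_starM HB), (br_starC HB), Se.
    now symmetry.
- rewrite (plus_idem HB); apply IHu, Pe.
- rewrite value_maxi; split.
  + intros [q (a & Ea & <- & _)]; exact (below_plus HB _ _ Ea).
  + intro E; exists (e * (word_value (word u))^m)^*, (e * (word_value (word u))^m).
    assert (F : (e * (word_value (word u))^m)^+ = e).
    { rewrite <- Pe at 1; now rewrite (br_plusM HB), Pe. }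
    now rewrite F.
Qed.

End Projections.

(** * The Munn graph of a path *)

Section Munn.
Context {X : Type}.

Definition edges (w : list (step X)) : list (nat * list X * nat) :=
  fold_right (fun (a : step X) es =>
    (if fst a then (0, snd (snd a), 1) else (1, snd (snd a), 0))
    :: map (fun e => (S (fst (fst e)), snd (fst e), S (snd e))) es) [] w.

(** A mark sits at the source of its edge, hence at [1] when the step goes backwards. *)
Definition marks (w : list (step X)) : list (list X * nat) :=
  fold_right (fun (a : step X) ms =>
    (if fst (snd a) then [(snd (snd a), if fst a then 0 else 1)] else [])
    ++ map (fun m => (fst m, S (snd m))) ms) [] w.

Inductive derived (l r : bool) (es : list (nat * list X * nat)) :
    nat -> list X -> nat -> Prop :=
| der_init p u q : In (p, u, q) es -> derived l r es p u q
| der_comp p q s u v :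
    derived l r es p u q -> derived l r es q v s -> derived l r es p (u ++ v) s
| der_left p q s u v : v = [] \/ l = true ->
    derived l r es p u q -> derived l r es p (u ++ v) s -> derived l r es q v s
| der_right p q s u v : u = [] \/ r = true ->
    derived l r es p (u ++ v) s -> derived l r es q v s -> derived l r es p u q.

(** The edge at [0] matters only for the empty path. *)
Definition munn_graph (l r : bool) (w : list (step X)) : graph X :=
  {| vertex := nat;
     edge := derived l r ((0, [], 0) :: edges w);
     mark := fun u p => exists q, In (u, q) (marks w) /\
               derived l r ((0, [], 0) :: edges w) q [] p |}.

Lemma munn_graph_closed l r w : closed l r (munn_graph l r w).
Proof.
split; cbn.
- intros *; apply der_comp.
- intros *; apply der_left.
- intros *; apply der_right.
- intros p q u E [s [I F]]; exists s; split; [exact I |].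
  exact (der_comp _ _ _ _ _ _ _ _ F E).
Qed.

Definition mapped (G : graph X) (g : nat -> vertex G) (w : list (step X)) : Prop :=
  (forall p u q, In (p, u, q) (edges w) -> edge G (g p) u (g q)) /\
  (forall u p, In (u, p) (marks w) -> mark G u (g p)).

Lemma mapped_cons (G : graph X) (g : nat -> vertex G) a w :
  mapped G g (a :: w) <-> traverse G a (g 0) (g 1) /\ mapped G (fun i => g (S i)) w.
Proof.
unfold mapped, traverse; cbn; split.
- intros [HE HM]; repeat split.
  + destruct a as [[] [b u]]; cbn in *; split; [now apply HE; left | | now apply HE; left |];
      intros ->; apply HM; now left.
  + intros p u q I; apply HE; right; apply in_map_iff; now exists (p, u, q).
  + intros u p I; apply HM; apply in_or_app; right; apply in_map_iff; now exists (u, p).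
- intros [F [HE HM]]; split.
  + intros p u q [E|I].
    * destruct a as [[] [b v]]; cbn in *; injection E as <- <- <-; tauto.
    * apply in_map_iff in I; destruct I as [[[p' u'] q'] [E I]]; cbn in E.
      injection E as <- <- <-; auto.
  + intros u p I; apply in_app_or in I; destruct I as [I|I].
    * destruct a as [[] [[] v]]; cbn in *; try easy; destruct I as [E|[]];
        injection E as <- <-; tauto.
    * apply in_map_iff in I; destruct I as [[u' p'] [E I]]; cbn in E.
      injection E as <- <-; auto.
Qed.

Lemma mapped_walk l r (G : graph X) (HG : closed l r G) (g : nat -> vertex G) w :
  edge G (g 0) [] (g 0) -> mapped G g w -> walk G w (g 0) (g (length w)).
Proof.
revert g; induction w as [|a w IH]; cbn; intros g E M; [exact E |].
apply mapped_cons in M; destruct M as [F M]; exists (g 1); split; [exact F |].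
exact (IH (fun i => g (S i)) (traverse_target HG _ _ _ F) M).
Qed.

Lemma walk_mapped (G : graph X) w p q :
  walk G w p q -> exists g : nat -> vertex G, g 0 = p /\ mapped G g w.
Proof.
revert p; induction w as [|a w IH]; cbn; intro p.
- intros _; exists (fun _ => p); repeat split; easy.
- intros [s [F W]]; destruct (IH _ W) as [g [E M]].
  exists (fun i => match i with 0 => p | S i => g i end); split; [reflexivity |].
  apply mapped_cons; now rewrite E.
Qed.

Lemma derived_mapped l r (G : graph X) (HG : closed l r G) (g : nat -> vertex G) es p u q :
  (forall p u q, In (p, u, q) es -> edge G (g p) u (g q)) ->
  derived l r es p u q -> edge G (g p) u (g q).
Proof.
intros H D; induction D as [| p q s u v _ E1 _ E2 | p q s u v b _ E1 _ E2
  | p q s u v b _ E1 _ E2].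
- auto.
- exact (cl_comp HG _ _ _ _ _ E1 E2).
- exact (cl_left HG _ _ _ _ _ b E1 E2).
- exact (cl_right HG _ _ _ _ _ b E1 E2).
Qed.

Lemma dom_hom (G H : graph X) (g : vertex G -> vertex H) :
  (forall p u q, edge G p u q -> edge H (g p) u (g q)) ->
  (forall u p, mark G u p -> mark H u (g p)) ->
  forall t p, dom G t p -> dom H t (g p).
Proof.
intros HE HM; induction t as [x| |u IHu v IHv|u IHu|u IHu|u IHu]; cbn; intro p.
- intros [D [q E]]; split; [exact (HM _ _ D) | exists (g q); exact (HE _ _ _ E)].
- apply HE.
- intros [D [q [E D']]]; split; [exact (IHu _ D) | exists (g q)].
  split; [exact (HE _ _ _ E) | exact (IHv _ D')].
- intros [q [D E]]; exists (g q); split; [exact (IHu _ D) | exact (HE _ _ _ E)].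
- apply IHu.
- intros [q E]; exists (g q); exact (HE _ _ _ E).
Qed.

(** The Munn graph is universal: a walk along [w] from [p] maps its linear graph into [G] with [0]
    sent to [p], and closedness of [G] extends the map to all derived edges. *)
Lemma munn_graph_hom l r (G : graph X) (HG : closed l r G) w t p q :
  walk G w p q -> dom (munn_graph l r w) t 0 -> dom G t p.
Proof.
intros W D; destruct (walk_mapped _ _ _ _ W) as [g [E M]]; rewrite <- E.
assert (HE : forall p u q, edge (munn_graph l r w) p u q -> edge G (g p) u (g q)).
{ intros p' u q'; apply (derived_mapped l r G HG); intros p'' u' q'' [I|I].
  - injection I as <- <- <-; rewrite E; exact (walk_source HG _ _ _ W).
  - now apply M. }
apply (dom_hom (munn_graph l r w) G g HE); [| exact D].
intros u p' [s [I F]]; apply (cl_mark HG (g s)); [now apply HE | now apply M].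
Qed.

Lemma munn_graph_dom l r (t : term X) : dom (munn_graph l r (path t)) t 0.
Proof.
pose proof (munn_graph_closed l r (path t)) as HG.
apply (walk_path HG t 0 (length (path t))).
apply (mapped_walk l r _ HG (fun i => i)); cbn; [now apply der_init; left |].
assert (HE : forall p u q, In (p, u, q) (edges (path t)) ->
  derived l r ((0, [], 0) :: edges (path t)) p u q).
{ intros p u q I; apply der_init; now right. }
split; [exact HE |]; intros u p I; exists p; split; [exact I |].
(* Marks hold up to an empty edge, so a loop at [p] is required; the edge at which the mark was
   placed provides it. *)
assert (F : exists q, edge (munn_graph l r (path t)) p u q).
{ cut (exists q, In (p, u, q) (edges (path t)));
    [intros [q Q]; exists q; exact (HE _ _ _ Q) |].
  clear HG HE; revert p I; induction (path t) as [|a w IH]; cbn; intros p I; [easy |].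
  apply in_app_or in I; destruct I as [I|I].
  - destruct a as [[] [[] v]]; cbn in *; try easy; destruct I as [E|[]];
      injection E as <- <-; eauto.
  - apply in_map_iff in I; destruct I as [[u' p'] [E I]]; cbn in E.
    injection E as <- <-; destruct (IH _ I) as [q J]; exists (S q); right.
    apply in_map_iff; now exists (p', u', q). }
destruct F as [q F]; exact (edge_source HG _ _ _ F).
Qed.

Definition accepted (l r : bool) (s t : term X) : Prop :=
  word s = word t /\ dom (munn_graph l r (path s)) t 0 /\
  dom (munn_graph l r (path t)) s 0.

(** In the graph of projections [s] can be read at [s^+]; by universality so can [t], which means
    [s^+ <= t^+]. *)
Lemma dom_le l r (S : algebra) (HS : in_class l r S) (f : X -> S) (s t : term X) :
  dom (munn_graph l r (path s)) t 0 ->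
  mul (plus (value f s)) (plus (value f t)) = plus (value f s).
Proof.
pose proof (proj1 (proj1 HS)) as HB; pose proof (projection_graph_closed HS f) as HG.
intro D; apply (dom_projection_graph HS f); [apply (plus_idem HB) |].
assert (Ds : dom (projection_graph f) s (plus (value f s))).
{ apply (dom_projection_graph HS f); [apply (plus_idem HB) | apply (plus_plus HB)]. }
destruct (dom_edge HG _ _ Ds) as [q E].
exact (munn_graph_hom l r _ HG _ _ _ q (proj2 (walk_path HG _ _ _) (conj Ds E)) D).
Qed.

Definition valid (V : algebra -> Prop) (s t : term X) : Prop :=
  forall (A : algebra) (f : X -> A), V A -> value f s = value f t.

Theorem valid_iff_accepted l r (s t : term X) :
  valid (in_class l r) s t <-> accepted l r s t.
Proof.
split.
- assert (H : forall s t, valid (in_class l r) s t ->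
    word s = word t /\ dom (munn_graph l r (path s)) t 0).
  { clear s t; intros s t H; pose proof (munn_graph_closed l r (path s)) as HG.
    (* In the algebra of the Munn graph of [s], the domain of [s] contains [0] and the label of a
       value is its word; equal values pass both on to [t]. *)
    specialize (H _ (model_gen HG) (model_in_class HG)).
    split; [now rewrite <- !(label_value HG), H |].
    rewrite <- (domain_value HG), <- H, (domain_value HG); apply munn_graph_dom. }
  intro V; destruct (H _ _ V) as [E D]; split; [exact E | split; [exact D |]].
  apply H; intros A f HA; symmetry; exact (V A f HA).
- intros [E [D1 D2]] A f HA; pose proof (proj1 HA) as HF.
  rewrite (maxi_plus HF (value f s)), (maxi_plus HF (value f t)).
  rewrite !(value_maxi HA), E; f_equal.
  apply (le_antisym (proj1 HF)); [exact (dom_le l r A HA f s t D1) |].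
  exact (dom_le l r A HA f t s D2).
Qed.

End Munn.

(** * Saturation *)

Fixpoint tree_eqb (a b : tree) : bool :=
  match a, b with
  | leaf, leaf => true
  | node a1 a2, node b1 b2 => tree_eqb a1 b1 && tree_eqb a2 b2
  | _, _ => false
  end.

Lemma tree_eqbP a b : tree_eqb a b = true <-> a = b.
Proof.
revert b; induction a as [|a1 IH1 a2 IH2]; intros [|b1 b2]; cbn; try easy.
rewrite andb_true_iff, IH1, IH2; split; [now intros [-> ->] | now intros [= -> ->]].
Qed.

Class Enc (A : Type) : Type := {
  enc : A -> tree;
  enc_inj : forall a b, enc a = enc b -> a = b
}.

Definition eqe {A} {EA : Enc A} (a b : A) : bool := tree_eqb (enc a) (enc b).

Lemma eqeP {A} {EA : Enc A} (a b : A) : eqe a b = true <-> a = b.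
Proof. unfold eqe; rewrite tree_eqbP; split; [apply enc_inj | now intros ->]. Qed.

Lemma eqe_refl {A} {EA : Enc A} (a : A) : eqe a a = true.
Proof. now apply eqeP. Qed.

#[export] Instance enc_tree : Enc tree := {| enc := fun t => t; enc_inj := fun a b E => E |}.

#[export] Program Instance enc_bool : Enc bool := {| enc := tree_of_bool |}.
Next Obligation. now destruct a, b. Qed.

#[export] Program Instance enc_nat : Enc nat := {| enc := tree_of_nat |}.
Next Obligation. revert b H; induction a; intros [|b]; cbn; try easy; intros [= E]; auto. Qed.

#[export] Program Instance enc_pair {A B} `{Enc A} `{Enc B} : Enc (A * B) :=
  {| enc := fun x => node (enc (fst x)) (enc (snd x)) |}.
Next Obligation. cbn in *; f_equal; now apply enc_inj. Qed.

Fixpoint tree_of_list {A} (ea : A -> tree) (l : list A) : tree :=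
  match l with
  | [] => leaf
  | a :: l => node (ea a) (tree_of_list ea l)
  end.

#[export] Program Instance enc_list {A} `{Enc A} : Enc (list A) :=
  {| enc := tree_of_list enc |}.
Next Obligation.
revert b H0; induction a; intros [|b0 b]; cbn; try easy; intros [= E1 E2].
f_equal; [exact (enc_inj _ _ E1) | exact (IHa _ E2)].
Qed.

Definition memb {A} {EA : Enc A} (a : A) (l : list A) : bool := existsb (fun b => eqe a b) l.

Lemma membP {A} {EA : Enc A} (a : A) (l : list A) : memb a l = true <-> In a l.
Proof.
unfold memb; rewrite existsb_exists; split.
- intros [b [I E]]; now rewrite (proj1 (eqeP _ _) E).
- intro I; exists a; split; [exact I | apply eqe_refl].
Qed.

(** Only the length of [u] counts, so the same function serves on reversed words; [conclusions]
    checks afterwards that the part removed was [u]. *)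
Definition drop {A} (u w : list A) : list A := fold_left (fun v _ => tl v) u w.

Lemma drop_app {A} (u v : list A) : drop u (u ++ v) = v.
Proof. unfold drop; now induction u. Qed.

Lemma drop_length {A} (u u' w : list A) : length u = length u' -> drop u w = drop u' w.
Proof.
unfold drop; revert u' w; induction u as [|x u IH]; intros [|x' u'] w; cbn; try easy.
intros [= L]; now apply IH.
Qed.

Section Saturation.
Context {X : Type} {EX : Enc X} (l r : bool).
Notation arrow := (nat * list X * nat)%type.

(** In the last two rules [a] is the known short side of the triangle and [b] the long one; [v] and
    [v'] are the candidates for what remains when [u] is removed as a prefix or as a suffix. *)
Definition conclusions (a b : arrow) : list arrow :=
  let p := fst (fst a) in let u := snd (fst a) in let q := snd a in
  let p' := fst (fst b) in let w := snd (fst b) in let q' := snd b in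
  let v := drop u w in let v' := rev (drop u (rev w)) in
  (if eqe q p' then [(p, u ++ w, q')] else []) ++
  (if eqe p p' && (eqe (u ++ v) w && (l || eqe v [])) then [(q, v, q')] else []) ++
  (if eqe q q' && (eqe (v' ++ u) w && (r || eqe v' [])) then [(p', v', p)] else []).

Definition fresh (es : list arrow) : list arrow :=
  filter (fun e => negb (memb e es))
    (flat_map (fun a => flat_map (fun b => conclusions a b) es) es).

Definition extend (es : list arrow) : list arrow := fresh es ++ es.

Lemma conclusions_sound es a b e :
  derived l r es (fst (fst a)) (snd (fst a)) (snd a) ->
  derived l r es (fst (fst b)) (snd (fst b)) (snd b) ->
  In e (conclusions a b) -> derived l r es (fst (fst e)) (snd (fst e)) (snd e).
Proof.
destruct a as [[p u] q], b as [[p' w] q']; unfold conclusions; cbn [fst snd].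
intros Da Db I.
rewrite !in_app_iff in I; destruct I as [I|[I|I]].
- destruct (eqe q p') eqn:E; [| easy]; rewrite eqeP in E; subst p'.
  destruct I as [<-|[]]; exact (der_comp _ _ _ _ _ _ _ _ Da Db).
- destruct (_ && _) eqn:E; [| easy]; rewrite !andb_true_iff, orb_true_iff, !eqeP in E.
  destruct E as [-> [E F]], I as [<-|[]]; rewrite <- E in Db; cbn.
  refine (der_left _ _ _ _ _ _ _ _ _ Da Db); tauto.
- destruct (_ && _) eqn:E; [| easy]; rewrite !andb_true_iff, orb_true_iff, !eqeP in E.
  destruct E as [-> [E F]], I as [<-|[]]; rewrite <- E in Db; cbn.
  refine (der_right _ _ _ _ _ _ _ _ _ Db Da); tauto.
Qed.

Lemma fresh_sound es T e :
  (forall e, In e T -> derived l r es (fst (fst e)) (snd (fst e)) (snd e)) ->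
  In e (fresh T) -> derived l r es (fst (fst e)) (snd (fst e)) (snd e).
Proof.
intros H I; apply filter_In in I; destruct I as [I _].
apply in_flat_map in I; destruct I as [a [Ia I]].
apply in_flat_map in I; destruct I as [b [Ib I]].
exact (conclusions_sound es a b e (H _ Ia) (H _ Ib) I).
Qed.

Lemma saturated_complete es T p u q :
  fresh T = [] -> incl es T -> derived l r es p u q -> In (p, u, q) T.
Proof.
intros F H D.
assert (C : forall a b, In a T -> In b T -> incl (conclusions a b) T).
{ intros a b Ia Ib e I; destruct (memb e T) eqn:E; [now apply membP |].
  assert (J : In e (fresh T)).
  { apply filter_In; rewrite E; split; [| easy].
    apply in_flat_map; exists a; split; [exact Ia |].
    apply in_flat_map; exists b; now split. }
  now rewrite F in J. }
induction D as [| p q s u v _ E1 _ E2 | p q s u v b _ E1 _ E2 | p q s u v b _ E1 _ E2].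
- now apply H.
- apply (C _ _ E1 E2); unfold conclusions; cbn [fst snd].
  rewrite !in_app_iff, eqe_refl; now left; left.
- apply (C _ _ E1 E2); unfold conclusions; cbn [fst snd].
  rewrite drop_app, !in_app_iff, !eqe_refl.
  right; left; destruct b as [-> | ->]; cbn; rewrite ?orb_true_r; now left.
- apply (C _ _ E2 E1); unfold conclusions; cbn [fst snd]; rewrite rev_app_distr.
  assert (Ed : drop v (rev v ++ rev u) = rev u).
  { rewrite (drop_length v (rev v)); [apply drop_app | symmetry; apply length_rev]. }
  rewrite Ed, rev_involutive, !in_app_iff, !eqe_refl.
  right; right; destruct b as [-> | ->]; cbn; rewrite ?orb_true_r; now left.
Qed.

(** A linear graph has no cycles, so heights can be prescribed one vertex at a time: the rest of the
    path fixes vertex [1], and the first step then fixes vertex [0]. *)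
Lemma potential (w : list (step X)) : exists h : nat -> Z,
  forall p u q, In (p, u, q) (edges w) -> (Z.of_nat (length u) + h p = h q)%Z.
Proof.
induction w as [|a w [h H]]; [now exists (fun _ => 0%Z) |].
set (n := Z.of_nat (length (snd (snd a)))).
exists (fun i => match i with
  | 0 => if fst a then (h 0%nat - n)%Z else (h 0%nat + n)%Z | S i => h i end).
intros p u q [E|I].
- destruct a as [[] [b v]]; cbn in E; injection E as <- <- <-; cbn in *; lia.
- apply in_map_iff in I; destruct I as [[[p' u'] q'] [E I]]; cbn in E.
  injection E as <- <- <-; auto.
Qed.

Fixpoint words (al : list X) (n : nat) : list (list X) :=
  match n with
  | 0 => [[]]
  | S n => flat_map (fun x => map (cons x) (words al n)) al
  end.

Lemma in_words al w : incl w al -> In w (words al (length w)).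
Proof.
induction w as [|x w IH]; cbn; intro H; [now left |].
apply in_flat_map; exists x; split; [apply H; now left |].
apply in_map, IH; intros y I; apply H; now right.
Qed.

(** Every rule preserves the equation of [potential], so two ends leave one possible length for the
    label, and [words] lists the candidates of that length. *)
Lemma derived_finite (w : list (step X)) : exists U : list arrow,
  forall p u q, derived l r ((0, [], 0) :: edges w) p u q -> In (p, u, q) U.
Proof.
destruct (potential w) as [h H].
set (es := (0, [], 0) :: edges w).
set (vs := flat_map (fun e => [fst (fst e); snd e]) es).
set (al := flat_map (fun e => snd (fst e)) es).
exists (flat_map (fun p => flat_map (fun q =>
  map (fun u => (p, u, q)) (words al (Z.to_nat (h q - h p)))) vs) vs).
intros p u q D.
assert (P : In p vs /\ In q vs /\ incl u al /\ (Z.of_nat (length u) + h p = h q)%Z).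
{ induction D as [p u q I | p q s u v _ E1 _ E2 | p q s u v b _ E1 _ E2
    | p q s u v b _ E1 _ E2].
  - repeat split.
    + apply in_flat_map; exists (p, u, q); cbn; auto.
    + apply in_flat_map; exists (p, u, q); cbn; auto.
    + intros x J; apply in_flat_map; exists (p, u, q); cbn; auto.
    + destruct I as [E|I]; [now injection E as <- <- <- | now apply H].
  - destruct E1 as (? & ? & ? & ?), E2 as (? & ? & ? & ?); rewrite length_app.
    repeat split; auto; [now apply incl_app | lia].
  - destruct E1 as (? & ? & ? & ?), E2 as (? & ? & J & K); rewrite length_app in K.
    repeat split; auto; [| lia]; intros x I; apply J, in_or_app; auto.
  - destruct E1 as (? & ? & J & K), E2 as (? & ? & ? & ?); rewrite length_app in K.
    repeat split; auto; [| lia]; intros x I; apply J, in_or_app; auto. }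
destruct P as (Ip & Iq & Iu & E).
apply in_flat_map; exists p; split; [exact Ip |].
apply in_flat_map; exists q; split; [exact Iq |].
apply (in_map (fun u => (p, u, q))); replace (Z.to_nat (h q - h p)) with (length u) by lia.
now apply in_words.
Qed.

Definition missing (U T : list arrow) : list arrow := filter (fun e => negb (memb e T)) U.

Lemma missing_extend (U T : list arrow) : incl (fresh T) U -> fresh T <> [] ->
  length (missing U (extend T)) < length (missing U T).
Proof.
unfold missing; intros H N.
(* The weak inequality handles the remainder of [U] once [e] has been met. *)
assert (G : forall U,
  length (filter (fun e => negb (memb e (extend T))) U) <=
    length (filter (fun e => negb (memb e T)) U) /\
  forall e, In e U -> In e (fresh T) ->
    length (filter (fun e => negb (memb e (extend T))) U) <
      length (filter (fun e => negb (memb e T)) U)).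
{ clear U H N; intro U; induction U as [|a U [IH1 IH2]]; cbn; [split; easy |].
  assert (M : memb a T = true -> memb a (extend T) = true).
  { rewrite !membP; unfold extend; rewrite in_app_iff; auto. }
  split.
  - destruct (memb a T); [rewrite M by easy; exact IH1 |].
    destruct (memb a (extend T)); cbn; lia.
  - intros e I F; destruct I as [->|I].
    + assert (E1 : memb e (extend T) = true) by (apply membP, in_or_app; auto).
      assert (E2 : memb e T = false).
      { apply filter_In in F; now destruct (memb e T). }
      rewrite E1, E2; cbn; lia.
    + specialize (IH2 e I F); destruct (memb a T); [now rewrite M by easy |].
      destruct (memb a (extend T)); cbn; lia. }
destruct (fresh T) as [|e F] eqn:E; [easy |].
apply (proj2 (G U) e); [apply H |]; now left.
Qed.

Lemma saturation_ends (w : list (step X)) :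
  exists n, fresh (Nat.iter n extend ((0, [], 0) :: edges w)) = [].
Proof.
destruct (derived_finite w) as [U H]; set (es := (0, [], 0) :: edges w) in *.
assert (D : forall n e, In e (Nat.iter n extend es) ->
  derived l r es (fst (fst e)) (snd (fst e)) (snd e)).
{ induction n as [|n IH]; cbn; intros e I.
  - destruct e as [[p u] q]; now apply der_init.
  - apply in_app_or in I; destruct I as [I|I]; [exact (fresh_sound _ _ _ IH I) | auto]. }
assert (L : forall k n, length (missing U (Nat.iter n extend es)) <= k ->
  exists n, fresh (Nat.iter n extend es) = []).
{ induction k as [|k IH]; intros n K; destruct (fresh (Nat.iter n extend es)) eqn:E;
    eauto; pose proof (missing_extend U (Nat.iter n extend es)) as M; rewrite E in M;
    (assert (M' : length (missing U (extend (Nat.iter n extend es))) <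
       length (missing U (Nat.iter n extend es)))
     by (apply M; [| easy]; rewrite <- E; intros [[p' u'] q'] I; apply H;
         exact (fresh_sound _ _ _ (D n) I))).
  - lia.
  - apply (IH (S n)).
    change (Nat.iter (S n) extend es) with (extend (Nat.iter n extend es)); lia. }
exact (L _ 0 (le_n _)).
Qed.

(** The number of rounds is not computed: the program stops when [fresh] is empty. *)
Definition rounds (w : list (step X)) : nat :=
  proj1_sig (constructive_indefinite_description _ (saturation_ends w)).

Definition saturate (w : list (step X)) : list arrow :=
  Nat.iter (rounds w) extend ((0, [], 0) :: edges w).

Lemma saturate_fresh w : fresh (saturate w) = [].
Proof. unfold saturate, rounds; now destruct constructive_indefinite_description. Qed.

Lemma in_saturate w p u q :
  In (p, u, q) (saturate w) <-> derived l r ((0, [], 0) :: edges w) p u q.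
Proof.
split.
- intro I; change (derived l r ((0, [], 0) :: edges w)
    (fst (fst (p, u, q))) (snd (fst (p, u, q))) (snd (p, u, q))).
  revert I; generalize (p, u, q); unfold saturate; induction (rounds w) as [|n IH];
    cbn; intros e I.
  + destruct e as [[p' u'] q']; now apply der_init.
  + apply in_app_or in I; destruct I as [I|I]; [exact (fresh_sound _ _ _ IH I) | auto].
- apply saturated_complete; [apply saturate_fresh |].
  unfold saturate; induction (rounds w) as [|n IH]; cbn; [apply incl_refl |].
  intros e I; apply in_or_app; right; auto.
Qed.

Definition marked (ms : list (list X * nat)) (T : list arrow) (u : list X) (p : nat) : bool :=
  existsb (fun m => eqe (fst m) u && memb (snd m, [], p) T) ms.

Definition advance (ms : list (list X * nat)) (T : list arrow) (ps : list nat)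
    (a : step X) : list nat :=
  flat_map (fun p => flat_map (fun e =>
    if eqe p (if fst a then fst (fst e) else snd e) &&
       (eqe (snd (snd a)) (snd (fst e)) &&
        (negb (fst (snd a)) || marked ms T (snd (snd a)) (fst (fst e))))
    then [if fst a then snd e else fst (fst e)] else []) T) ps.

Definition reach (w w' : list (step X)) : list nat :=
  fold_left (advance (marks w) (saturate w)) w' [0].

Lemma in_advance w ps a q :
  In q (advance (marks w) (saturate w) ps a) <->
  exists p, In p ps /\ traverse (munn_graph l r w) a p q.
Proof.
assert (M : forall u p, marked (marks w) (saturate w) u p = true <->
  mark (munn_graph l r w) u p).
{ intros u p; unfold marked; rewrite existsb_exists; cbn -[eqe memb]; split.
  - intros [[u' s] [I E]]; rewrite andb_true_iff, eqeP, membP, in_saturate in E.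
    cbn in E; destruct E as [-> E]; eauto.
  - intros [s [I E]]; exists (u, s); split; [exact I |].
    rewrite andb_true_iff, eqeP, membP, in_saturate; auto. }
unfold advance; rewrite in_flat_map; split.
- intros [p [Ip I]]; exists p; split; [exact Ip |].
  apply in_flat_map in I; destruct I as [[[p' u] q'] [I J]]; apply in_saturate in I.
  destruct (_ && _) eqn:E; [| easy].
  rewrite !andb_true_iff, orb_true_iff, M, !eqeP, negb_true_iff in E.
  destruct a as [[] [b v]]; cbn in *; destruct E as [-> [-> E]], J as [<-|[]];
    (split; [exact I | intros ->; now destruct E]).
- intros [p [Ip F]]; exists p; split; [exact Ip |]; apply in_flat_map.
  destruct a as [[] [b v]]; cbn -[eqe] in *; destruct F as [I D];
    apply in_saturate in I; [exists (p, v, q) | exists (q, v, p)];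
    (split; [exact I |]); cbn -[eqe]; rewrite !eqe_refl; cbn;
    (destruct b; cbn; [rewrite (proj2 (M _ _) (D eq_refl)) |]); now left.
Qed.

Lemma in_reach w w' q :
  In q (reach w w') -> walk (munn_graph l r w) w' 0 q.
Proof.
pose proof (munn_graph_closed l r w) as HG.
intro I; unfold reach in I.
assert (B : edge (munn_graph l r w) 0 [] 0) by (apply der_init; now left).
revert q I; induction w' as [|a w' IH] using rev_ind; cbn; intros q I.
- destruct I as [<-|[]]; exact B.
- rewrite fold_left_app in I; apply in_advance in I; destruct I as [p [I F]].
  apply (walk_app HG); exists p; split; [auto | now apply (walk_single HG)].
Qed.

(** An empty walk may end at any vertex joined to [0] by an empty edge, whereas [reach] starts from
    [0] alone; the induction therefore matches end vertices only up to empty edges. *)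
Lemma reach_nonempty w w' q : walk (munn_graph l r w) w' 0 q -> reach w w' <> [].
Proof.
pose proof (munn_graph_closed l r w) as HG.
intro W; cut (exists p, edge (munn_graph l r w) p [] q /\ In p (reach w w')).
{ now intros [p [_ I]]; destruct (reach w w'). }
revert q W; unfold reach; induction w' as [|a w' IH] using rev_ind; intros q W.
- exists 0; split; [exact W | now left].
- apply (walk_app HG) in W; destruct W as [s [W F]]; apply (walk_single HG) in F.
  destruct (IH _ W) as [p [E I]]; rewrite fold_left_app.
  pose proof (traverse_cong HG _ _ _ _ (edge_sym HG _ _ E) F) as F'.
  exists q; split; [exact (traverse_target HG _ _ _ F') |].
  apply in_advance; eauto.
Qed.

Definition accepts (v v' : list X * list (step X)) : bool :=
  eqe (fst v) (fst v') &&
  (negb (eqe (reach (snd v) (snd v')) []) && negb (eqe (reach (snd v') (snd v)) [])).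

Lemma acceptsP (s t : term X) :
  accepts (word s, path s) (word t, path t) = true <-> accepted l r s t.
Proof.
assert (R : forall s t, negb (eqe (reach (path s) (path t)) []) = true <->
  dom (munn_graph l r (path s)) t 0).
{ clear s t; intros s t; pose proof (munn_graph_closed l r (path s)) as HG.
  rewrite negb_true_iff, <- not_true_iff_false, eqeP; split.
  - intro N; destruct (reach _ _) as [|q ps] eqn:E; [easy |].
    apply (walk_path HG t 0 q), in_reach; rewrite E; now left.
  - intro D; destruct (dom_edge HG _ _ D) as [q E].
    apply (reach_nonempty _ _ q), (walk_path HG); auto. }
unfold accepts, accepted; cbn [fst snd]; now rewrite !andb_true_iff, !R, eqeP.
Qed.

End Saturation.

(** * Computable functions *)

Fixpoint at_head (e : expr) : expr :=
  match e with
  | Var => Hd Var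
  | Nil => Nil
  | Cons e1 e2 => Cons (at_head e1) (at_head e2)
  | Hd e => Hd (at_head e)
  | Tl e => Tl (at_head e)
  end.

(** With a single variable, data survive a subprogram only if it runs on the head. *)
Fixpoint on_head (p : program) : program :=
  match p with
  | Assign e => Assign (Cons (at_head e) (Tl Var))
  | Seq p q => Seq (on_head p) (on_head q)
  | While e p => While (at_head e) (on_head p)
  end.

Lemma eval_at_head e x z : eval (at_head e) (node x z) = eval e x.
Proof.
induction e as [| |e1 IH1 e2 IH2|e IH|e IH]; cbn; auto;
  rewrite ?IH, ?IH1, ?IH2; reflexivity.
Qed.

Lemma exec_on_head p x y z : exec p x y -> exec (on_head p) (node x z) (node y z).
Proof.
induction 1 as [e x|p q x y t _ IH1 _ IH2|e p x E|e p x y t E _ IH1 _ IH2]; cbn.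
- rewrite <- (eval_at_head e x z).
  exact (exec_assign (Cons (at_head e) (Tl Var)) (node x z)).
- exact (exec_seq IH1 IH2).
- apply exec_while_false; now rewrite eval_at_head.
- apply (exec_while_true (y:=node y z)); auto; now rewrite eval_at_head.
Qed.

Lemma exec_expr e x y : eval e x = y -> exec (Assign e) x y.
Proof. intros <-; apply exec_assign. Qed.

Lemma exec_once e p x y : eval e x <> leaf -> exec p x y -> eval e y = leaf ->
  exec (While e p) x y.
Proof.
intros N H E; exact (exec_while_true N H (exec_while_false _ E)).
Qed.

Lemma exec_pair p q : exists s, forall x y z,
  exec p x y -> exec q x z -> exec s x (node y z).
Proof.
exists (Seq (Assign (Cons Var Var)) (Seq (on_head q)
  (Seq (Assign (Cons (Tl Var) (Hd Var))) (on_head p)))).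
intros x y z Hp Hq.
apply (exec_seq (y:=node x x)); [apply exec_assign |].
apply (exec_seq (y:=node z x)); [now apply exec_on_head |].
apply (exec_seq (y:=node x z)); [apply exec_assign | now apply exec_on_head].
Qed.

(** The second loop tests a flag which the first one clears. *)
Lemma exec_branch p q s : exists u, forall x c y, exec p x c ->
  (c <> leaf -> exec q (node x c) y) -> (c = leaf -> exec s x y) -> exec u x y.
Proof.
destruct (exec_pair (Assign Var) p) as [d Hd'].
set (stop := Assign (Cons (Hd Var) (Cons Nil Nil))).
exists (Seq d (Seq (Assign (Cons Var (Cons (Tl Var) (Cons Nil Nil))))
  (Seq (While (Hd (Tl Var)) (Seq (on_head q) stop))
  (Seq (While (Tl (Tl Var)) (Seq (on_head (Assign (Hd Var))) (Seq (on_head s) stop)))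
  (Assign (Hd Var)))))).
intros x c y Hp Hq Hs.
apply (exec_seq (y:=node x c)); [apply Hd'; [exact (exec_assign Var x) | exact Hp] |].
apply (exec_seq (y:=node (node x c) (node c (node leaf leaf)))); [apply exec_assign |].
assert (T : forall z, exec stop (node y z) (node y (node leaf leaf)))
  by (intro z; apply exec_assign).
destruct c as [|c1 c2].
- apply (exec_seq (y:=node (node x leaf) (node leaf (node leaf leaf))));
    [now apply exec_while_false |].
  apply (exec_seq (y:=node y (node leaf leaf))); [| apply exec_assign].
  apply exec_once; [easy | | reflexivity].
  apply (exec_seq (y:=node x (node leaf (node leaf leaf)))).
  + apply exec_on_head, exec_assign.
  + apply (exec_seq (y:=node y (node leaf (node leaf leaf)))); [| apply T].
    now apply exec_on_head, Hs.
- apply (exec_seq (y:=node y (node leaf leaf))).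
  + apply exec_once; [easy | | reflexivity].
    apply (exec_seq (y:=node y (node (node c1 c2) (node leaf leaf)))); [| apply T].
    now apply exec_on_head, Hq.
  + apply (exec_seq (y:=node y (node leaf leaf))); [now apply exec_while_false |].
    apply exec_assign.
Qed.

Definition computable {A B} {EA : Enc A} {EB : Enc B} (f : A -> B) : Prop :=
  exists p, forall a, exec p (enc a) (enc (f a)).

Lemma c_expr {A B} {EA : Enc A} {EB : Enc B} (e : expr) (f : A -> B) :
  (forall a, eval e (enc a) = enc (f a)) -> computable f.
Proof. intro H; exists (Assign e); intro a; now apply exec_expr. Qed.

Lemma c_comp {A B C} {EA : Enc A} {EB : Enc B} {EC : Enc C} (g : B -> C) (f : A -> B) :
  computable g -> computable f -> computable (fun a => g (f a)).
Proof.
intros [q Hq] [p Hp]; exists (Seq p q); intro a; exact (exec_seq (Hp a) (Hq _)).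
Qed.

Section Combinators.
Context {E A B : Type} {EE : Enc E} {EA : Enc A} {EB : Enc B}.

Lemma c_id : computable (fun a : A => a).
Proof. now apply (c_expr Var). Qed.

Lemma c_const (b : B) : computable (fun _ : A => b).
Proof.
assert (H : forall t, exists e, forall x, eval e x = t).
{ induction t as [|t1 [e1 H1] t2 [e2 H2]]; [now exists Nil |].
  exists (Cons e1 e2); intro x; cbn; now rewrite H1, H2. }
destruct (H (enc b)) as [e He]; now apply (c_expr e).
Qed.

Lemma c_pair (f : E -> A) (g : E -> B) :
  computable f -> computable g -> computable (fun e => (f e, g e)).
Proof.
intros [p Hp] [q Hq]; destruct (exec_pair p q) as [s Hs]; exists s; intro e.
exact (Hs _ _ _ (Hp e) (Hq e)).
Qed.

Lemma c_fst (f : E -> A * B) : computable f -> computable (fun e => fst (f e)).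
Proof. apply (c_comp (fun x => fst x)); now apply (c_expr (Hd Var)). Qed.

Lemma c_snd (f : E -> A * B) : computable f -> computable (fun e => snd (f e)).
Proof. apply (c_comp (fun x => snd x)); now apply (c_expr (Tl Var)). Qed.

Lemma c_cons (f : E -> A) (g : E -> list A) :
  computable f -> computable g -> computable (fun e => f e :: g e).
Proof.
intros [p Hp] [q Hq]; destruct (exec_pair p q) as [s Hs]; exists s; intro e.
exact (Hs _ _ _ (Hp e) (Hq e)).
Qed.

Lemma c_node (f g : E -> tree) :
  computable f -> computable g -> computable (fun e => node (f e) (g e)).
Proof.
intros [p Hp] [q Hq]; destruct (exec_pair p q) as [s Hs]; exists s; intro e.
exact (Hs _ _ _ (Hp e) (Hq e)).
Qed.

Lemma c_S (f : E -> nat) : computable f -> computable (fun e => S (f e)).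
Proof. apply (c_comp S); now apply (c_expr (Cons Nil Var)). Qed.

Lemma c_if (b : E -> bool) (f g : E -> A) :
  computable b -> computable f -> computable g ->
  computable (fun e => if b e then f e else g e).
Proof.
intros [p Hp] [q Hq] [s Hs].
(* The first branch receives the input paired with the value of the test, and [Hd] restores the
   input. *)
destruct (exec_branch p (Seq (Assign (Hd Var)) q) s) as [u Hu]; exists u; intro e.
apply (Hu _ _ _ (Hp e)); destruct (b e); cbn; try easy; intros _.
exact (exec_seq (exec_assign (Hd Var) (node _ _)) (Hq e)).
Qed.

(** Since [[]] is encoded by [leaf], the list itself serves as the test, and the pair handed to the
    first branch is already the encoding of [(e, (a, l))]. *)
Lemma c_list_case (l : E -> list A) (f : E -> B) (g : E -> A -> list A -> B) :
  computable l -> computable f ->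
  computable (fun x : E * (A * list A) => g (fst x) (fst (snd x)) (snd (snd x))) ->
  computable (fun e => match l e with [] => f e | a :: l => g e a l end).
Proof.
intros [p Hp] [s Hs] [q Hq].
destruct (exec_branch p q s) as [u Hu]; exists u; intro e.
apply (Hu _ _ _ (Hp e)); destruct (l e) as [|a l']; cbn; try easy; intros _.
exact (Hq (e, (a, l'))).
Qed.

Lemma c_tree_case (t : E -> tree) (f : E -> B) (g : E -> tree -> tree -> B) :
  computable t -> computable f ->
  computable (fun x : E * (tree * tree) => g (fst x) (fst (snd x)) (snd (snd x))) ->
  computable (fun e => match t e with leaf => f e | node a b => g e a b end).
Proof.
intros [p Hp] [s Hs] [q Hq].
destruct (exec_branch p q s) as [u Hu]; exists u; intro e.
apply (Hu _ _ _ (Hp e)); destruct (t e) as [|a b]; cbn; try easy; intros _.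
exact (Hq (e, (a, b))).
Qed.

(** The count [n] is not assumed computable. The loop is governed by [b], and as [f] fixes the
    points where [b] fails, stopping before [n] rounds gives the same result. *)
Lemma c_iter (n : E -> nat) (f : A -> A) (b : A -> bool) (g : E -> A) :
  computable f -> computable b -> computable g ->
  (forall a, b a = false -> f a = a) ->
  (forall e, b (Nat.iter (n e) f (g e)) = false) ->
  computable (fun e => Nat.iter (n e) f (g e)).
Proof.
intros [p Hp] [q Hq] [s Hs] fix_f end_f.
destruct (exec_pair q (Assign Var)) as [d Hd'].
assert (Hs' : forall a, exec d (enc a) (node (enc (b a)) (enc a))).
{ intro a; apply Hd'; [apply Hq | exact (exec_assign Var (enc a))]. }
exists (Seq s (Seq d (Seq (While (Hd Var) (Seq (Assign (Tl Var)) (Seq p d)))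
  (Assign (Tl Var))))).
intro e; apply (exec_seq (Hs e)); specialize (end_f e).
apply (exec_seq (Hs' _)).
apply (exec_seq (y:=node (enc false) (enc (Nat.iter (n e) f (g e)))));
  [| exact (exec_assign (Tl Var) (node _ _))].
revert end_f; generalize (g e); induction (n e) as [|k IH]; intros a H.
- cbn in H; rewrite H; now apply exec_while_false.
- destruct (b a) eqn:Eb.
  + rewrite Nat.iter_succ_r in *.
    apply (exec_while_true (y:=node (enc (b (f a))) (enc (f a)))); [easy | | now apply IH].
    apply (exec_seq (y:=enc a)); [exact (exec_assign (Tl Var) (node _ _)) |].
    exact (exec_seq (Hp a) (Hs' (f a))).
  + replace (Nat.iter (S k) f a) with a; [now apply exec_while_false |].
    symmetry; apply Nat.iter_invariant; [| reflexivity]; intros x ->; auto.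
Qed.

End Combinators.

(** * Compiling functions on lists into programs *)

Ltac comp_step :=
  first [ apply c_const | match goal with
  | |- computable (fun e => e) => apply c_id
  | |- computable (fun e => fst (@?f e)) => apply (c_fst f)
  | |- computable (fun e => snd (@?f e)) => apply (c_snd f)
  | |- computable (fun e => (@?f e, @?g e)) => apply (c_pair f g)
  | |- computable (fun e => @?f e :: @?g e) => apply (c_cons f g)
  | |- computable (fun e => node (@?f e) (@?g e)) => apply (c_node f g)
  | |- computable (fun e => S (@?f e)) => apply (c_S f)
  | |- computable (fun e => if @?b e then @?f e else @?g e) => apply (c_if b f g)
  | |- computable (fun e => match @?l e with [] => @?f e | a :: m => @?g e a m end) =>
      apply (c_list_case l f g)
  | |- computable (fun e => match @?t e with leaf => @?f e | node a b => @?g e a b end) =>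
      apply (c_tree_case t f g)
  end ].
Ltac comp := cbv beta; repeat (comp_step; cbv beta).

Lemma c_fold_left {E A B} {EE : Enc E} {EA : Enc A} {EB : Enc B}
    (g : E -> B -> A -> B) (l : E -> list A) (i : E -> B) :
  computable (fun x : E * (B * A) => g (fst x) (fst (snd x)) (snd (snd x))) ->
  computable l -> computable i ->
  computable (fun e => fold_left (g e) (l e) (i e)).
Proof.
intros Hg Hl Hi.
(* The loop state holds the parameter [e], the rest of the list and the accumulator; a finished list
   makes it a fixed point. *)
set (f := fun s : E * (list A * B) => match fst (snd s) with
  | [] => s
  | a :: l => (fst s, (l, g (fst s) (snd (snd s)) a)) end).
assert (H : forall l e b,
  Nat.iter (length l) f (e, (l, b)) = (e, ([], fold_left (g e) l b))).
{ intro l'; induction l' as [|a l' IH]; intros e b; [reflexivity |].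
  cbn [length]; rewrite Nat.iter_succ_r; apply IH. }
replace (fun e => fold_left (g e) (l e) (i e))
  with (fun e => snd (snd (Nat.iter (length (l e)) f (e, (l e, i e)))))
  by (apply functional_extensionality; intro e; now rewrite H).
apply c_snd, c_snd.
apply (c_iter _ f (fun s => match fst (snd s) with [] => false | _ => true end)).
- unfold f; comp.
  apply (c_comp (fun x : E * (B * A) => g (fst x) (fst (snd x)) (snd (snd x)))
    (fun x : E * (list A * B) * (A * list A) =>
       (fst (fst x), (snd (snd (fst x)), fst (snd x))))); [exact Hg | comp].
- comp.
- comp; assumption.
- intros [e [[|a l'] b]]; cbn; easy.
- intro e; now rewrite H.
Qed.

Lemma c_rev {E A} {EE : Enc E} {EA : Enc A} (l : E -> list A) :
  computable l -> computable (fun e => rev (l e)).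
Proof.
intro Hl; replace (fun e => rev (l e))
  with (fun e => fold_left (fun acc a => a :: acc) (l e) []).
- apply (c_fold_left (fun _ acc a => a :: acc)); comp; exact Hl.
- apply functional_extensionality; intro e; rewrite <- fold_left_rev_right.
  generalize (rev (l e)); intro w; induction w as [|a w IH]; cbn; congruence.
Qed.

Lemma c_fold_right {E A B} {EE : Enc E} {EA : Enc A} {EB : Enc B}
    (g : E -> A -> B -> B) (l : E -> list A) (i : E -> B) :
  computable (fun x : E * (A * B) => g (fst x) (fst (snd x)) (snd (snd x))) ->
  computable l -> computable i ->
  computable (fun e => fold_right (g e) (i e) (l e)).
Proof.
intros Hg Hl Hi; replace (fun e => fold_right (g e) (i e) (l e))
  with (fun e => fold_left (fun b a => g e a b) (rev (l e)) (i e)).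
- apply (c_fold_left (fun e b a => g e a b)); [| now apply c_rev | exact Hi].
  apply (c_comp (fun x : E * (A * B) => g (fst x) (fst (snd x)) (snd (snd x)))
    (fun x : E * (B * A) => (fst x, (snd (snd x), fst (snd x))))); [exact Hg | comp].
- apply functional_extensionality; intro e.
  now rewrite <- fold_left_rev_right, rev_involutive.
Qed.

Section Lists.
Context {E A B : Type} {EE : Enc E} {EA : Enc A} {EB : Enc B}.

Lemma c_app (l l' : E -> list A) :
  computable l -> computable l' -> computable (fun e => l e ++ l' e).
Proof.
intros Hl Hl'; replace (fun e => l e ++ l' e)
  with (fun e => fold_right (fun a acc => a :: acc) (l' e) (l e)).
- apply (c_fold_right (fun _ a acc => a :: acc)); comp; assumption.
- apply functional_extensionality; intro e.
  generalize (l e); intro w; induction w; cbn; congruence.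
Qed.

Lemma c_map (f : E -> A -> B) (l : E -> list A) :
  computable (fun x : E * A => f (fst x) (snd x)) -> computable l ->
  computable (fun e => map (f e) (l e)).
Proof.
intros Hf Hl; replace (fun e => map (f e) (l e))
  with (fun e => fold_right (fun a acc => f e a :: acc) [] (l e)).
- apply (c_fold_right (fun e a acc => f e a :: acc)); comp; [| assumption].
  apply (c_comp (fun x : E * A => f (fst x) (snd x))
    (fun x : E * (A * list B) => (fst x, fst (snd x)))); [exact Hf | comp].
- apply functional_extensionality; intro e.
  generalize (l e); intro w; induction w; cbn; congruence.
Qed.

Lemma c_tl (l : E -> list A) : computable l -> computable (fun e => tl (l e)).
Proof. intro Hl; unfold tl; comp; exact Hl. Qed.

End Lists.

Lemma c_flat_map {E A B} {EE : Enc E} {EA : Enc A} {EB : Enc B}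
    (f : E -> A -> list B) (l : E -> list A) :
  computable (fun x : E * A => f (fst x) (snd x)) -> computable l ->
  computable (fun e => flat_map (f e) (l e)).
Proof.
intros Hf Hl; replace (fun e => flat_map (f e) (l e))
  with (fun e => fold_right (fun a acc => f e a ++ acc) [] (l e)).
- apply (c_fold_right (fun e a acc => f e a ++ acc)); [apply c_app | ..]; comp;
    [| assumption].
  apply (c_comp (fun x : E * A => f (fst x) (snd x))
    (fun x : E * (A * list B) => (fst x, fst (snd x)))); [exact Hf | comp].
- apply functional_extensionality; intro e.
  generalize (l e); intro w; induction w; cbn; congruence.
Qed.

Lemma c_filter {E A} {EE : Enc E} {EA : Enc A} (f : E -> A -> bool) (l : E -> list A) :
  computable (fun x : E * A => f (fst x) (snd x)) -> computable l ->
  computable (fun e => filter (f e) (l e)).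
Proof.
intros Hf Hl; replace (fun e => filter (f e) (l e))
  with (fun e => flat_map (fun a => if f e a then [a] else []) (l e)).
- apply c_flat_map; comp; assumption.
- apply functional_extensionality; intro e.
  generalize (l e); intro w; induction w as [|a w IH]; cbn; [reflexivity |].
  rewrite IH; now destruct (f e a).
Qed.

Lemma c_existsb {E A} {EE : Enc E} {EA : Enc A} (f : E -> A -> bool) (l : E -> list A) :
  computable (fun x : E * A => f (fst x) (snd x)) -> computable l ->
  computable (fun e => existsb (f e) (l e)).
Proof.
intros Hf Hl; replace (fun e => existsb (f e) (l e))
  with (fun e => match filter (f e) (l e) with [] => false | _ :: _ => true end).
- comp; now apply c_filter.
- apply functional_extensionality; intro e.
  generalize (l e); intro w; induction w as [|a w IH]; cbn; [reflexivity |].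
  now destruct (f e a).
Qed.

(** * Deciding equality of trees *)

Fixpoint tree_size (t : tree) : nat :=
  match t with leaf => 1 | node a b => S (tree_size a + tree_size b) end.

Lemma tree_size_pos t : 0 < tree_size t.
Proof. destruct t; cbn; lia. Qed.

(** A mismatch empties the work list, which gives at once the fixed point that [c_iter] requires. *)
Definition eq_step (s : bool * list (tree * tree)) : bool * list (tree * tree) :=
  match snd s with
  | [] => s
  | c :: st => match fst c with
    | leaf => match snd c with leaf => (fst s, st) | node _ _ => (false, []) end
    | node a1 a2 => match snd c with
      | leaf => (false, [])
      | node b1 b2 => (fst s, (a1, b1) :: (a2, b2) :: st)
      end
    end
  end.

(** Each successful comparison consumes one node of the left-hand trees, so their total size bounds
    the number of steps. *)
Lemma eq_step_iter n s :
  fold_right (fun c k => tree_size (fst c) + k) 0 (snd s) <= n ->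
  Nat.iter n eq_step s =
    (fst s && forallb (fun c => tree_eqb (fst c) (snd c)) (snd s), []) \/
  Nat.iter n eq_step s = (false, []) /\
    forallb (fun c => tree_eqb (fst c) (snd c)) (snd s) = false.
Proof.
assert (stop : forall k b, Nat.iter k eq_step (b, []) = (b, [])).
{ intros k b; induction k as [|k IH]; [reflexivity | now rewrite Nat.iter_succ_r]. }
revert s; induction n as [|n IH]; intros [r [|[a b] st]];
  cbn [fst snd fold_right forallb]; intro L;
  try (rewrite stop, andb_true_r; now left).
- pose proof (tree_size_pos a); cbn in L; lia.
- rewrite Nat.iter_succ_r; destruct a as [|a1 a2], b as [|b1 b2]; cbn [tree_eqb andb].
  + apply IH; cbn in *; lia.
  + right; split; [apply stop | reflexivity].
  + right; split; [apply stop | reflexivity].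
  + rewrite <- andb_assoc; apply (IH (r, (a1, b1) :: (a2, b2) :: st)); cbn in *; lia.
Qed.

Lemma tree_eqb_iter a b :
  Nat.iter (tree_size a) eq_step (true, [(a, b)]) = (tree_eqb a b, []).
Proof.
destruct (eq_step_iter (tree_size a) (true, [(a, b)])) as [E|[E F]]; [cbn; lia | ..];
  rewrite E; cbn in *; rewrite andb_true_r in *; [reflexivity | now rewrite F].
Qed.

Lemma c_eqe {E A} {EE : Enc E} {EA : Enc A} (f g : E -> A) :
  computable f -> computable g -> computable (fun e => eqe (f e) (g e)).
Proof.
intros [p Hp] [q Hq].
assert (H : computable (fun x : tree * tree => tree_eqb (fst x) (snd x))).
{ replace (fun x : tree * tree => tree_eqb (fst x) (snd x))
    with (fun x => fst (Nat.iter (tree_size (fst x)) eq_step (true, [x])))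
    by (apply functional_extensionality; intros [a b]; now rewrite tree_eqb_iter).
  apply c_fst, (c_iter _ eq_step (fun s => match snd s with [] => false | _ => true end)).
  - unfold eq_step; comp.
  - comp.
  - comp.
  - intros [r [|c st]]; cbn; easy.
  - intros [a b]; now rewrite tree_eqb_iter. }
destruct H as [u Hu], (exec_pair p q) as [s Hs]; exists (Seq s u); intro e.
exact (exec_seq (Hs _ _ _ (Hp e) (Hq e)) (Hu (enc (f e), enc (g e)))).
Qed.

(** * Recursion on trees *)

Fixpoint tree_fold {B} (b : B) (g : tree -> B -> B -> B) (t : tree) : B :=
  match t with
  | leaf => b
  | node t1 t2 => g t (tree_fold b g t1) (tree_fold b g t2)
  end.

(** A stack machine for [tree_fold]: in the work list, [(false, t)] asks for the value
    of [t], and [(true, t)] for the combination of the two values of its subtrees. *)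
Definition fold_step {B} (b : B) (g : tree -> B -> B -> B)
    (s : list (bool * tree) * list B) : list (bool * tree) * list B :=
  match fst s with
  | [] => s
  | c :: w =>
    if fst c then
      match snd s with
      | [] => (w, [])
      | v2 :: vs => match vs with [] => (w, []) | v1 :: vs => (w, g (snd c) v1 v2 :: vs) end
      end
    else match snd c with
      | leaf => (w, b :: snd s)
      | node t1 t2 => ((false, t1) :: (false, t2) :: (true, node t1 t2) :: w, snd s)
      end
  end.

Lemma fold_step_iter {B} (b : B) g t : exists n, forall w vs,
  Nat.iter n (fold_step b g) ((false, t) :: w, vs) = (w, tree_fold b g t :: vs).
Proof.
induction t as [|t1 [n1 H1] t2 [n2 H2]]; [now exists 1 |].
exists (1 + (n2 + S n1)); intros w vs; rewrite !Nat.iter_add.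
rewrite (Nat.iter_succ_r n1); change (fold_step b g ((false, node t1 t2) :: w, vs))
  with ((false, t1) :: (false, t2) :: (true, node t1 t2) :: w, vs).
now rewrite H1, H2.
Qed.

Lemma c_tree_fold {E B} {EE : Enc E} {EB : Enc B} (b : B) (g : tree -> B -> B -> B)
    (t : E -> tree) :
  computable (fun x : tree * (B * B) => g (fst x) (fst (snd x)) (snd (snd x))) ->
  computable t -> computable (fun e => tree_fold b g (t e)).
Proof.
intros Hg Ht.
(* The running time of the stack machine is obtained by choice; [c_iter] uses it only in its
   specification. *)
set (n := fun t => proj1_sig (constructive_indefinite_description _ (fold_step_iter b g t))).
assert (H : forall t, Nat.iter (n t) (fold_step b g) ([(false, t)], []) =
  ([], [tree_fold b g t])).
{ intro u; unfold n; destruct constructive_indefinite_description as [k Hk]; apply Hk. }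
replace (fun e => tree_fold b g (t e)) with (fun e =>
  match snd (Nat.iter (n (t e)) (fold_step b g) ([(false, t e)], [])) with
  | [] => b | v :: _ => v end)
  by (apply functional_extensionality; intro e; now rewrite H).
apply c_list_case; [| apply c_const | comp].
apply c_snd, (c_iter _ (fold_step b g)
  (fun s => match fst s with [] => false | _ => true end)).
- unfold fold_step; comp.
  match goal with |- computable (fun x : ?T => g (@?a x) (@?b x) (@?c x)) =>
    apply (c_comp (fun x : tree * (B * B) => g (fst x) (fst (snd x)) (snd (snd x)))
      (fun x : T => (a x, (b x, c x)))) end; [exact Hg | comp].
- comp.
- comp; exact Ht.
- intros [[|c w] vs]; cbn; easy.
- intro e; now rewrite H.
Qed.

Ltac comp_step ::=
  first [ assumption | apply c_const | match goal with
  | |- computable (fun e => e) => apply c_id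
  | |- computable (fun e => fst (@?f e)) => apply (c_fst f)
  | |- computable (fun e => snd (@?f e)) => apply (c_snd f)
  | |- computable (fun e => (@?f e, @?g e)) => apply (c_pair f g)
  | |- computable (fun e => @?f e :: @?g e) => apply (c_cons f g)
  | |- computable (fun e => node (@?f e) (@?g e)) => apply (c_node f g)
  | |- computable (fun e => S (@?f e)) => apply (c_S f)
  | |- computable (fun e => eqe (@?f e) (@?g e)) => apply (c_eqe f g)
  | |- computable (fun e => @?f e ++ @?g e) => apply (c_app f g)
  | |- computable (fun e => rev (@?f e)) => apply (c_rev f)
  | |- computable (fun e => tl (@?f e)) => apply (c_tl f)
  | |- computable (fun e => map (@?f e) (@?l e)) => apply (c_map f l)
  | |- computable (fun e => flat_map (@?f e) (@?l e)) => apply (c_flat_map f l)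
  | |- computable (fun e => filter (@?f e) (@?l e)) => apply (c_filter f l)
  | |- computable (fun e => existsb (@?f e) (@?l e)) => apply (c_existsb f l)
  | |- computable (fun e => fold_left (@?f e) (@?l e) (@?i e)) => apply (c_fold_left f l i)
  | |- computable (fun e => fold_right (@?f e) (@?i e) (@?l e)) => apply (c_fold_right f l i)
  | |- computable (fun e => if @?b e then @?f e else @?g e) => apply (c_if b f g)
  | |- computable (fun e => match @?l e with [] => @?f e | a :: m => @?g e a m end) =>
      apply (c_list_case l f g)
  | |- computable (fun e => match @?t e with leaf => @?f e | node a b => @?g e a b end) =>
      apply (c_tree_case t f g)
  end ].

(** * Computability of the decision procedure *)

Lemma c_fresh l r : computable (@fresh tree _ l r).
Proof. unfold fresh, memb, conclusions, drop, negb, andb, orb; cbv zeta; comp. Qed.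

Lemma c_saturate {E} {EE : Enc E} l r (w : E -> list (step tree)) :
  computable w -> computable (fun e => saturate l r (w e)).
Proof.
intro Hw.
apply (c_iter _ (extend l r) (fun es => negb (eqe (fresh l r es) []))).
- unfold extend; comp; apply c_fresh.
- unfold negb; comp; apply c_fresh.
- unfold edges; comp.
- intros es H; unfold extend; rewrite negb_false_iff, eqeP in H; now rewrite H.
- intro e; rewrite negb_false_iff, eqeP; apply saturate_fresh.
Qed.

Lemma c_accepts l r : computable (fun x => @accepts tree _ l r (fst x) (snd x)).
Proof.
assert (R : forall f g : (list tree * list (step tree)) * (list tree * list (step tree)) ->
  list (step tree), computable f -> computable g ->
  computable (fun x => reach l r (f x) (g x))).
{ intros f g Hf Hg; unfold reach.
  apply (c_comp (fun y => fold_left (advance (fst (fst y)) (snd (fst y))) (snd y) [0])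
    (fun x => ((marks (f x), saturate l r (f x)), g x))).
  - unfold advance, marked, memb, negb, andb, orb; comp.
  - comp; [unfold marks; comp | now apply c_saturate]. }
unfold accepts, negb, andb; comp; apply R; comp.
Qed.

(** The value at the subtree [node k x] is that of the term with tag [k], followed by
    the values at the two children, so that the payload [x] need not be a term. *)
Definition term_step (t : tree) (v1 v2 :
    (list tree * list (step tree)) *
    ((list tree * list (step tree)) * (list tree * list (step tree)))) :=
  let v := fst v2 in let w := fst (snd v2) in let w' := snd (snd v2) in
  (match t with
   | leaf => ([], [])
   | node k x =>
     if eqe k (tree_of_nat 0) then ([x], [(true, (true, [x]))])
     else if eqe k (tree_of_nat 1) then ([], [])
     else if eqe k (tree_of_nat 2) then (fst w ++ fst w', snd w ++ snd w')
     else if eqe k (tree_of_nat 3) then ([], inv (snd v) ++ snd v)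
     else if eqe k (tree_of_nat 4) then ([], snd v ++ inv (snd v))
     else (fst v, [(true, (false, fst v))])
   end, (fst v1, fst v2)).

Definition decode (t : tree) : list tree * list (step tree) :=
  fst (tree_fold (([], []), (([], []), ([], []))) term_step t).

Lemma c_decode {E} {EE : Enc E} (t : E -> tree) :
  computable t -> computable (fun e => decode (t e)).
Proof.
intro Ht; unfold decode; apply c_fst, c_tree_fold; [| exact Ht].
unfold term_step, inv, negb; cbv zeta; comp.
Qed.

(** * Names of letters, and identities in free algebras *)

Fixpoint rename {X Y : Type} (g : X -> Y) (t : term X) : term Y :=
  match t with
  | tvar x => tvar (g x)
  | tone => tone
  | tmul u v => tmul (rename g u) (rename g v)
  | tstar u => tstar (rename g u)
  | tplus u => tplus (rename g u)
  | tmaxi u => tmaxi (rename g u)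
  end.

(** The code of a letter is itself used as a letter, so the procedure runs over the alphabet [tree]
    whatever [X] is. *)
Lemma decode_term {X : Type} (c : X -> nat) (t : term X) :
  let s := rename (fun x => tree_of_nat (c x)) t in
  decode (tree_of_term c t) = (word s, path s).
Proof.
unfold decode; cbn zeta.
induction t as [x| |u IHu v IHv|u IHu|u IHu|u IHu]; cbn [tree_of_term tree_fold];
  [reflexivity | reflexivity | revert IHu IHv | revert IHu | revert IHu | revert IHu];
  generalize (tree_fold ([], [], ([], [], ([], []))) term_step (tree_of_term c u));
  try generalize (tree_fold ([], [], ([], [], ([], []))) term_step (tree_of_term c v)); cbn.
- intros p q E F; now rewrite E, F.
- intros p E; now rewrite E.
- intros p E; now rewrite E.
- intros p E; now rewrite E.
Qed.

Lemma value_rename {X Y : Type} (S : algebra) (g : X -> Y) (f : Y -> S) (t : term X) :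
  value f (rename g t) = value (fun x => f (g x)) t.
Proof. induction t; cbn; congruence. Qed.

Lemma value_ext {X : Type} (S : algebra) (f g : X -> S) (t : term X) :
  (forall x, occurs x t -> f x = g x) -> value f t = value g t.
Proof. induction t; cbn; intro H; f_equal; auto. Qed.

Lemma valid_rename {X : Type} (V : algebra -> Prop) (s t : term X) (c : X -> nat) :
  names_letters c s t ->
  (valid V (rename (fun x => tree_of_nat (c x)) s) (rename (fun x => tree_of_nat (c x)) t)
   <-> valid V s t).
Proof.
intro N; split; intros H A f VA.
(* Naming is injective only on the letters of [s] and [t], so [h] inverts it there and takes the
   default [one] elsewhere. This choice does not enter the program. *)
- set (h := fun y => match excluded_middle_informative
    (exists x, (occurs x s \/ occurs x t) /\ tree_of_nat (c x) = y) with
  | left E => f (proj1_sig (constructive_indefinite_description _ E))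
  | right _ => one end).
  assert (K : forall x, occurs x s \/ occurs x t -> f x = h (tree_of_nat (c x))).
  { intros x O; unfold h; destruct excluded_middle_informative as [E|E].
    - destruct constructive_indefinite_description as [x' [O' E']]; cbn; f_equal.
      apply N; auto; apply (enc_inj (A := nat)); now symmetry.
    - destruct E; eauto. }
  rewrite (value_ext A f (fun x => h (tree_of_nat (c x))) s) by auto.
  rewrite (value_ext A f (fun x => h (tree_of_nat (c x))) t) by auto.
  rewrite <- (value_rename A (fun x => tree_of_nat (c x)) h s).
  rewrite <- (value_rename A (fun x => tree_of_nat (c x)) h t); now apply H.
- rewrite !value_rename; now apply H.
Qed.

Lemma free_valid {X : Type} (V : algebra -> Prop) (F : algebra) (i : X -> F) :
  is_free V i -> forall s t, value i s = value i t <-> valid V s t.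
Proof.
intros [VF U] s t; split; [| intro H; now apply H].
intros E A f VA; destruct (U A f VA) as [h [[M Hi] _]].
assert (K : forall u, h (value i u) = value f u).
{ induction u as [x| |u IHu v IHv|u IHu|u IHu|u IHu]; cbn.
  - apply Hi.
  - apply (morph_one M).
  - now rewrite (morph_mul M), IHu, IHv.
  - now rewrite (morph_star M), IHu.
  - now rewrite (morph_plus M), IHu.
  - now rewrite (morph_maxi M), IHu. }
now rewrite <- !K, E.
Qed.

Theorem word_problem_decidable {X : Type} (l r : bool) (V : algebra -> Prop) :
  (forall A, V A <-> in_class l r A) ->
  forall (F : algebra) (i : X -> F), is_free V i -> decidable_word_problem i.
Proof.
intros HV F i HF.
assert (C : computable (fun x : tree * tree =>
  accepts l r (decode (fst x)) (decode (snd x)))).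
{ apply (c_comp (fun y => accepts l r (fst y) (snd y))
    (fun x : tree * tree => (decode (fst x), decode (snd x)))); [apply c_accepts |].
  apply c_pair; apply c_decode;
    [apply (c_fst (fun x => x)) | apply (c_snd (fun x => x))]; comp. }
destruct C as [p Hp]; exists p; intros s t c N.
exists (accepts l r (decode (tree_of_term c s)) (decode (tree_of_term c t))); split.
- exact (Hp (tree_of_term c s, tree_of_term c t)).
- rewrite !decode_term, acceptsP, <- valid_iff_accepted.
  rewrite (free_valid V F i HF), <- (valid_rename V s t c N).
  now split; intros H A f VA; apply H, HV.
Qed.

Theorem theorem10p2 (X : Type) (hX : inhabited X) :
  (forall (FFBR_ls : algebra) (i : X -> FFBR_ls),
     is_free left_strong i -> decidable_word_problem i) /\
  (forall (FFBR_rs : algebra) (i : X -> FFBR_rs),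
     is_free right_strong i -> decidable_word_problem i) /\
  (forall (FFBR_s : algebra) (i : X -> FFBR_s),
     is_free strong i -> decidable_word_problem i).
Proof.
split; [| split].
- apply (word_problem_decidable true false); intro A; split.
  + intros [HF HL]; split; [exact HF | split; [intros _; exact HL | discriminate]].
  + intros [HF [HL _]]; split; [exact HF | now apply HL].
- apply (word_problem_decidable false true); intro A; split.
  + intros [HF HR]; split; [exact HF | split; [discriminate | intros _; exact HR]].
  + intros [HF [_ HR]]; split; [exact HF | now apply HR].
- apply (word_problem_decidable true true); intro A; split.
  + intros [HF [HL HR]]; split; [exact HF | split; intros _; assumption].
  + intros [HF [HL HR]]; split; [exact HF | split; [now apply HL | now apply HR]].
Qed.
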